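(* Let $N\ge 2$ be an integer, $\delta>-1$, and $(c_k)_{k\ge1}$ positive numbers, and consider the random graph $\mathcal G_N$ on $\Omega_N$ in which distinct $x,y$ are joined by an edge independently with probability $\min\!\big(c_k/N^{k(1+\delta)},1\big)$, $k=d(x,y)$. (a) If $\delta>1$ and $\sup_k c_k<\infty$, then percolation does not occur. (b) If $\delta<1$ and $c=\inf_k c_k$ is large enough, then percolation occurs (through a chain of clusters in $k$-balls), and the percolation cluster (the infinite cluster) is unique.
   Context: $\Omega_N$ is the set of sequences $x=(x_1,x_2,\dots)$ with $x_i\in\{0,1,\dots,N-1\}$ and only finitely many $x_i\neq 0$ (a group under componentwise addition mod $N$). The hierarchical distance is $d(x,y)=0$ if $x=y$ and $d(x,y)=\max\{i: x_i\ne y_i\}$ otherwise; it is an ultrametric. $\mathbf 0$ denotes the zero sequence. For $k\ge1$, a $k$-ball is a set $\{y:d(x,y)\le k\}$ (it has $N^k$ points). All edges of $\mathcal G_N$ are independent. A cluster is a connected component of the graph. Percolation is said to occur if, with positive probability, $\mathbf 0$ belongs to an infinite cluster. *)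

(* Defs.v *)
From HB Require Import structures.
From Stdlib Require Import Relations List.
From mathcomp Require Import all_boot all_order all_algebra.
From mathcomp Require Import all_classical all_reals all_analysis.
Set Implicit Arguments. Unset Strict Implicit. Unset Printing Implicit Defensive.
Import Order.TTheory GRing.Theory Num.Theory.
Local Open Scope classical_set_scope.
Local Open Scope ring_scope.

(* Omega_N : sequences x = (x_1, x_2, ...) with x_i in {0,..,N-1}, finitely
   many nonzero.  Represented as x : nat -> nat; coordinate 0 is unused and
   fixed to 0; coordinates i >= 1 are the paper's x_i. *)
Definition Omega (N : nat) : Type :=
  {x : nat -> nat |
     (forall i, (x i < N)%N) /\ x 0%N = 0%N /\
     exists n, forall i, (n < i)%N -> x i = 0%N}.

Lemma zero_proof (N : nat) (hN : (0 < N)%N) :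
  (forall i, ((fun _ : nat => 0%N) i < N)%N) /\ (fun _ : nat => 0%N) 0%N = 0%N /\
  exists n, forall i, (n < i)%N -> (fun _ : nat => 0%N) i = 0%N.
Proof. split; [by [] | split; [by [] | by exists 0%N]]. Qed.

Definition zero (N : nat) (hN : (0 < N)%N) : Omega N :=
  exist _ (fun _ => 0%N) (zero_proof hN).

Definition is_hdist (N : nat) (x y : Omega N) (k : nat) : Prop :=
  proj1_sig x k <> proj1_sig y k /\
  forall i, (k < i)%N -> proj1_sig x i = proj1_sig y i.

(* A random graph on Omega_N: E x y t says "x and y are joined in the
   realisation t". *)
Definition connected (N : nat) (T : Type) (E : Omega N -> Omega N -> T -> bool)
  (t : T) : relation (Omega N) :=
  clos_refl_trans (Omega N) (fun a b => E a b t).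

Definition cluster (N : nat) (T : Type) (E : Omega N -> Omega N -> T -> bool)
  (t : T) (x : Omega N) : set (Omega N) := [set y | connected E t x y].

Definition in_infinite_cluster (N : nat) (T : Type)
  (E : Omega N -> Omega N -> T -> bool) (t : T) (x : Omega N) : Prop :=
  ~ finite_set (cluster E t x).

(* The random graph G_N with parameters delta and c on the probability space
   (T, P): the edge indicators are measurable, symmetric, mutually independent
   over distinct (unordered) pairs of distinct vertices, and
   P(x ~ y) = min(c_k / N^(k(1+delta)), 1) with k = d(x,y). *)
Definition GN_model (N : nat) (R : realType) (delta : R) (c : nat -> R)
  (d : measure_display) (T : measurableType d) (P : probability T R)
  (E : Omega N -> Omega N -> T -> bool) : Prop :=
  [/\ (forall x y, measurable [set t | E x y t]),
      (forall x y t, E x y t = E y x t),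
      (forall x y k, x <> y -> is_hdist x y k ->
         P [set t | E x y t] =
           (Num.min (c k / (N%:R `^ (k%:R * (1 + delta)))) 1)%:E) &
      (forall s : list (Omega N * Omega N),
         NoDup s ->
         (forall p, In p s -> p.1 <> p.2) ->
         (forall p q, In p s -> In q s -> p.1 = q.2 -> p.2 = q.1 -> False) ->
         P [set t | forall p, In p s -> E p.1 p.2 t] =
           \big[*%E/1%E]_(p <- s) P [set t | E p.1 p.2 t])].

Definition percolates (N : nat) (hN : (0 < N)%N) (R : realType)
  (d : measure_display) (T : measurableType d) (P : probability T R)
  (E : Omega N -> Omega N -> T -> bool) : Prop :=
  (0 < P [set t | in_infinite_cluster E t (zero hN)])%E.

Definition unique_infinite_cluster (N : nat) (R : realType)
  (d : measure_display) (T : measurableType d) (P : probability T R)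
  (E : Omega N -> Omega N -> T -> bool) : Prop :=
  P [set t | forall x y, in_infinite_cluster E t x ->
                         in_infinite_cluster E t y -> connected E t x y] = 1%E.

(* Main.v *)
Require Import Defs.
From HB Require Import structures.
From mathcomp Require Import all_boot all_order all_algebra.
From mathcomp Require Import all_classical all_reals all_analysis.
From mathcomp Require Import zify ring lra.
From Stdlib Require Import Relations.
Set Implicit Arguments. Unset Strict Implicit. Unset Printing Implicit Defensive.
Import Order.TTheory GRing.Theory Num.Theory.
Local Open Scope ring_scope.

(* Reading base-N digits identifies Omega_N with nat, a k-ball being a class of
   integers with the same quotient by N^k.

   (a) The expected number of edges leaving the k-ball of 0 is of order
   N^(k(1-delta)), which tends to 0, while an infinite cluster at 0 needs such
   an edge for every k.

   (b) Put M = N^L with L so large that 2 N^(L(1+delta)) <= (M-1)^2, and cut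
   each Ln-ball into M balls of level L(n-1). A ball is good when all but at
   most one of its sub-balls are good and the cores of the good ones are
   pairwise joined by an edge; its core is then the union of these, and has at
   least (M-1)^n points. Two good cores fail to be joined with probability at
   most of order 2^-n / C, so q_n = sup P(bad) satisfies
   q_(n+1) <= M^2 q_n^2 + O(2^-n / C), whence q_n <= 2^-n / (4 M^2) for C
   large. With positive probability all balls around 0 are good, and then 0 has
   an infinite cluster.

   Uniqueness: the cores of the balls around x are nested from some level on,
   so it suffices that an infinite cluster at x reaches one of them. Let z be
   the first vertex outside the n-ball of x that is adjacent to the part of the
   cluster explored inside this ball. The balls around z not yet containing x
   are independent of this exploration, and with probability >= 1/2 all of them
   are good; z, hence x, is then connected to a core. So if A_n is the event
   that x is not connected to its core inside the n-ball but its cluster leaves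
   this ball, P(A_n) is at most twice the probability that the connection to
   the cores is first made after level n, up to o(1), and P(A_n) tends to 0. *)

(** * Balls, cores and exploration *)

(* A realisation of the graph on [nat]; only the entries [(u, v)] with
   [u < v] are read, so each unordered edge has a single index. *)
Definition config : Type := (nat * nat -> bool)%type.

Definition adj (w : config) (u v : nat) : bool :=
  (u != v) && w (minn u v, maxn u v).

Definition conn (w : config) : relation nat := clos_refl_trans nat (adj w).

(** Entries are read with the vertex of [s] first, so edges are seen only when [s] lies below [s'],
    as do the cores of sub-balls [i < j]. *)
Definition linked (w : config) (s s' : seq nat) : bool :=
  has (fun u => has (fun v => w (u, v)) s') s.

(** Infinite means unbounded for a set of integers; in this form measurability reduces to that of
    connection events. *)
Definition infinite_at (w : config) (x : nat) : Prop :=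
  forall n, exists2 y, (n <= y)%N & conn w x y.

Lemma adjC w u v : adj w u v = adj w v u.
Proof. by rewrite /adj eq_sym minnC maxnC. Qed.

Lemma conn_sym w u v : conn w u v -> conn w v u.
Proof.
elim=> [x y xy|x|x y z _ xy _ yz].
- by apply: rt_step; rewrite adjC.
- exact: rt_refl.
- exact: rt_trans yz xy.
Qed.

Lemma count_gt1 (p : pred nat) n : (1 < count p (iota 0 n))%N ->
  exists i j, [/\ (i < j)%N, (j < n)%N, p i & p j].
Proof.
rewrite -size_filter; have := sorted_filter ltn_trans p (iota_ltn_sorted 0 n).
case E : [seq x <- iota 0 n | p x] => [|i [|j s]] //= /andP[ij _] _.
have mem x : x \in [:: i, j & s] -> p x /\ (x < n)%N.
  by rewrite -E mem_filter mem_iota add0n => /andP[-> /andP[_ ->]].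
have [pi _] := mem i (mem_head _ _).
have [pj jn] : p j /\ (j < n)%N by apply: mem; rewrite !inE eqxx orbT.
by exists i, j.
Qed.

Section Hierarchy.
Local Open Scope nat_scope.
Variable M : nat.
Hypothesis M_gt1 : 1 < M.

(* The [M ^ n]-point ball of level [n] around [x] is the fibre of [anc n]
   through [x]. *)
Definition anc (n x : nat) : nat := x %/ M ^ n.

Definition conn_in (w : config) (n a : nat) : relation nat :=
  clos_refl_trans nat
    (fun u v => [&& adj w u v, anc n u == a & anc n v == a]).

(* [core w n a] is empty when the ball fails to be good; a ball is good when at
   most one of its [M] sub-balls fails and the cores of the others are pairwise
   linked. *)
Fixpoint core (w : config) (n a : nat) : seq nat :=
  if n is k.+1 then
    let f i := core w k (a * M + i) in
    if (count (fun i => f i == [::]) (iota 0 M) <= 1) &&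
       [forall i : 'I_M, forall j : 'I_M,
          (i < j) ==> [|| f i == [::], f j == [::] | linked w (f i) (f j)]]
    then flatten [seq f i | i <- iota 0 M] else [::]
  else [:: a].

Definition good w n a : bool := core w n a != [::].

(** Indices of the edges inside a ball. Disjoint balls of one level have disjoint lists, which is
    the source of their independence. *)
Definition ball_pairs (n a : nat) : seq (nat * nat) :=
  [seq p <- allpairs pair (iota 0 (a.+1 * M ^ n)) (iota 0 (a.+1 * M ^ n)) |
     [&& anc n p.1 == a, anc n p.2 == a & p.1 < p.2]].

Lemma Mn_gt0 n : 0 < M ^ n.
Proof. by rewrite expn_gt0 (ltnW M_gt1). Qed.

Lemma ancS n x : anc n.+1 x = anc n x %/ M.
Proof. by rewrite /anc expnSr divnMA. Qed.

Lemma anc0 x : anc 0 x = x.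
Proof. by rewrite /anc expn0 divn1. Qed.

Lemma anc_lt n a x : anc n x = a -> x < a.+1 * M ^ n.
Proof. by move=> <-; rewrite /anc ltn_ceil // Mn_gt0. Qed.

Lemma anc_eq_le n m x y : n <= m -> anc n x = anc n y -> anc m x = anc m y.
Proof.
move=> /subnK <- xy; elim: (m - n) => [|k IH] //.
by rewrite addSn !ancS IH.
Qed.

Lemma anc_eventually x y : exists n, anc n x = anc n y.
Proof.
exists (x + y); rewrite /anc !divn_small //.
- by apply: leq_ltn_trans (ltn_expl _ M_gt1); exact: leq_addl.
- by apply: leq_ltn_trans (ltn_expl _ M_gt1); exact: leq_addr.
Qed.

Lemma mem_ball_pairs n a p :
  (p \in ball_pairs n a) = [&& anc n p.1 == a, anc n p.2 == a & p.1 < p.2].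
Proof.
rewrite mem_filter; case: (boolP [&& _, _ & _]) => //= /and3P[/eqP p1 /eqP p2 _].
case: p p1 p2 => u v /= p1 p2; apply/allpairsP; exists (u, v) => /=.
by rewrite !mem_iota !add0n !leq0n /=; split=> //; exact: anc_lt.
Qed.

Lemma sub_index a i : i < M -> (a * M + i) %/ M = a.
Proof.
by move=> iM; rewrite divnMDl ?(ltnW M_gt1) // divn_small // addn0.
Qed.

Lemma coreP w n a u : u \in core w n.+1 a ->
  exists2 i, i < M & u \in core w n (a * M + i).
Proof.
rewrite /=; case: ifP => // _ /flattenP[s /mapP[i]].
by rewrite mem_iota add0n => /andP[_ iM] -> ui; exists i.
Qed.

Lemma core_anc w n a u : u \in core w n a -> anc n u = a.
Proof.
elim: n a => [|n IH] a; first by rewrite inE anc0 => /eqP.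
by move=> /coreP[i iM /IH]; rewrite ancS => ->; exact: sub_index.
Qed.

Lemma core_uniq w n a : uniq (core w n a).
Proof.
elim: n a => [|n IH] a //=; case: ifP => // _.
elim: (iota 0 M) (iota_uniq 0 M) => [|i s IHs] //= /andP[is_ us].
rewrite cat_uniq IH IHs // andbT /=; apply/hasPn => u /flattenP[_ /mapP[j js ->]].
move=> uj; apply/negP => /core_anc ui; move/core_anc: uj; rewrite ui => /addnI ij.
by rewrite ij js in is_.
Qed.

Lemma core_goodS w n a : good w n.+1 a ->
  [/\ count (fun i => core w n (a * M + i) == [::]) (iota 0 M) <= 1,
    (forall i j, i < j -> j < M -> good w n (a * M + i) ->
       good w n (a * M + j) ->
       linked w (core w n (a * M + i)) (core w n (a * M + j))) &
    core w n.+1 a = flatten [seq core w n (a * M + i) | i <- iota 0 M]].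
Proof.
rewrite /good /=; case: ifP => // /andP[cnt /forallP lnk] _; split=> // i j ij jM.
have iM := ltn_trans ij jM.
move: (lnk (Ordinal iM)) => /forallP /(_ (Ordinal jM)) /implyP /(_ ij) /=.
by move=> /or3P[->|->|].
Qed.

(** The disjunction feeds a union bound over pairs of sub-balls. A passed test never yields an empty
    core: all [M > 1] sub-cores would have to be empty, while at most one is. *)
Lemma core_badS w n a : ~~ good w n.+1 a ->
  exists i j, [/\ i < j, j < M &
    (~~ good w n (a * M + i) /\ ~~ good w n (a * M + j)) \/
    [/\ good w n (a * M + i), good w n (a * M + j) &
        ~~ linked w (core w n (a * M + i)) (core w n (a * M + j))]].
Proof.
pose f i := core w n (a * M + i).
have [le1|gt1] := leqP (count (fun i => f i == [::]) (iota 0 M)) 1; last first.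
  have [i [j [ij jM fi fj]]] := count_gt1 gt1.
  by move=> _; exists i, j; split=> //; left; rewrite /good !negbK.
rewrite /good /= -/f le1 /=; case: ifP => [_|/negbT/forallPn[i /forallPn[j]]].
  rewrite negbK => /eqP fl.
  suff empty : all (fun i => f i == [::]) (iota 0 M).
    by move: empty le1; rewrite all_count size_iota => /eqP ->; rewrite leqNgt M_gt1.
  apply/allP => i iM.
  case E : (f i) => [//|u r].
  have : u \in flatten [seq f i | i <- iota 0 M].
    by apply/flattenP; exists (f i); rewrite ?map_f // E mem_head.
  by rewrite fl.
rewrite negb_imply => /andP[ij]; rewrite !negb_or => /and3P[fi fj nl] _.
by exists i, j; split=> //; right.
Qed.

Lemma core_sub w n a b u : good w n.+1 a -> b %/ M = a ->
  u \in core w n b -> u \in core w n.+1 a.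
Proof.
move=> /core_goodS[_ _ ->] <- ub; apply/flattenP; exists (core w n b) => //.
apply/mapP; exists (b %% M); last by rewrite -divn_eq.
by rewrite mem_iota add0n ltn_mod (ltnW M_gt1).
Qed.

Lemma core_chain w n m x u : n <= m ->
  (forall k, n < k <= m -> good w k (anc k x)) ->
  u \in core w n (anc n x) -> u \in core w m (anc m x).
Proof.
elim: m => [|m IH]; first by rewrite leqn0 => /eqP ->.
rewrite leq_eqVlt => /orP[/eqP ->//|]; rewrite ltnS => nm gd un.
apply: (@core_sub _ _ _ (anc m x)); rewrite ?ancS //.
  by rewrite -ancS; apply: gd; rewrite ltnS nm leqnn.
by apply: IH => // k /andP[nk km]; apply: gd; rewrite nk leqW.
Qed.

Lemma core_size w n a : good w n a -> (M.-1) ^ n <= size (core w n a).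
Proof.
elim: n a => [|n IH] a; [by []|move=> /core_goodS[cnt _ ->]].
rewrite size_flatten /shape -map_comp.
set b := fun i => core w n (a * M + i) == [::]; rewrite -/b in cnt.
have : M.-1 <= count (predC b) (iota 0 M).
  by have := count_predC b (iota 0 M); rewrite size_iota; lia.
move=> Mc; rewrite expnSr mulnC; apply: leq_trans (leq_mul Mc (leqnn _)) _.
elim: (iota 0 M) => [|i s IHs] //=; rewrite mulnDl leq_add //.
by rewrite /b; case: eqP => [//|/eqP gi] /=; rewrite mul1n; exact: IH.
Qed.

(** The recursion reads only edges between sub-balls [i < j], hence pairs [u < v] inside the
    ball. *)
Lemma core_eq (w w' : config) n a : {in ball_pairs n a, w =1 w'} ->
  core w n a = core w' n a.
Proof.
elim: n a => [//|n IH] a ww' /=.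
have sub i : i < M -> core w n (a * M + i) = core w' n (a * M + i).
  move=> iM; apply: IH => p; rewrite mem_ball_pairs => /and3P[/eqP p1 /eqP p2 p12].
  by apply: ww'; rewrite mem_ball_pairs !ancS p1 p2 p12 sub_index // eqxx.
have -> : [seq core w n (a * M + i) | i <- iota 0 M] =
          [seq core w' n (a * M + i) | i <- iota 0 M].
  by apply/eq_in_map => i; rewrite mem_iota => /andP[_]; exact: sub.
have -> : count (fun i => core w n (a * M + i) == [::]) (iota 0 M) =
          count (fun i => core w' n (a * M + i) == [::]) (iota 0 M).
  by apply/eq_in_count => i; rewrite mem_iota => /andP[_ /sub ->].
congr (if _ && _ then _ else _); apply: eq_forallb => i; apply: eq_forallb => j.
case ij: (i < j) => //=; rewrite !sub //; congr [|| _, _ | _].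
apply: eq_in_has => u ui; apply: eq_in_has => v vj.
move/core_anc: ui => ui; move/core_anc: vj => vj.
apply: ww'; rewrite mem_ball_pairs !ancS /= ui vj !sub_index // eqxx /=.
rewrite ltnNge; apply/negP => /(leq_div2r (M ^ n)); rewrite -!/(anc _ _) ui vj.
by rewrite leq_add2l leqNgt ij.
Qed.

Lemma conn_in_sym w n a u v : conn_in w n a u v -> conn_in w n a v u.
Proof.
elim=> [x y /and3P[xy xa ya]|x|x y z _ xy _ yz].
- by apply: rt_step; rewrite adjC xy xa ya.
- exact: rt_refl.
- exact: rt_trans yz xy.
Qed.

Lemma conn_in_sub w n m x u v : n <= m ->
  conn_in w n (anc n x) u v -> conn_in w m (anc m x) u v.
Proof.
move=> nm; elim=> [y z /and3P[yz /eqP ya /eqP za]|y|y z t _ yz _ zt].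
- by apply: rt_step; rewrite yz (anc_eq_le nm ya) (anc_eq_le nm za) eqxx.
- exact: rt_refl.
- exact: rt_trans yz zt.
Qed.

Lemma conn_in_conn w n a u v : conn_in w n a u v -> conn w u v.
Proof.
elim=> [y z /and3P[yz _ _]|y|y z t _ yz _ zt].
- exact: rt_step.
- exact: rt_refl.
- exact: rt_trans yz zt.
Qed.

Lemma conn_in_anc w n a u v : anc n u = a -> conn_in w n a u v -> anc n v = a.
Proof.
by move=> ua uv; elim: uv ua => // [y z /and3P[_ _ /eqP ->]//|y z t _ yz _ zt /yz /zt].
Qed.

Lemma conn_in_eq (w w' : config) n a u v : {in ball_pairs n a, w =1 w'} ->
  conn_in w n a u v -> conn_in w' n a u v.
Proof.
move=> ww'; elim=> [y z /and3P[yz ya za]|y|y z t _ yz _ zt].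
- apply: rt_step; rewrite ya za !andbT; move: yz; rewrite /adj.
  case: eqP => //= yz; rewrite ww' // mem_ball_pairs /=.
  rewrite /minn /maxn; case: ltngtP => zy //=; by rewrite ya za.
- exact: rt_refl.
- exact: rt_trans yz zt.
Qed.

Lemma core_conn w n a u v :
  u \in core w n a -> v \in core w n a -> conn_in w n a u v.
Proof.
elim: n a u v => [|n IH] a u v.
  by rewrite !inE => /eqP -> /eqP ->; exact: rt_refl.
move=> uc vc; have gd : good w n.+1 a by rewrite /good; case: core uc.
have [_ lnk _] := core_goodS gd.
have sub i y z : i < M -> y \in core w n (a * M + i) ->
    z \in core w n (a * M + i) -> conn_in w n.+1 a y z.
  move=> iM yi zi; have := IH _ _ _ yi zi; have ya := core_anc yi.
  rewrite -ya => /(conn_in_sub (leqnSn n)); by rewrite ancS ya sub_index.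
have main i j y z : i < j -> j < M -> y \in core w n (a * M + i) ->
    z \in core w n (a * M + j) -> conn_in w n.+1 a y z.
  move=> ij jM yi zj; have iM := ltn_trans ij jM.
  have /hasP[y' yi' /hasP[z' zj' yz']] : linked w (core w n (a * M + i))
      (core w n (a * M + j)).
    by apply: lnk => //; rewrite /good; [case: core yi|case: core zj].
  apply: rt_trans (sub _ _ _ iM yi yi') (rt_trans _ _ _ _ _ _ (sub _ _ _ jM zj' zj)).
  have yz : y' < z'.
    rewrite ltnNge; apply/negP => /(leq_div2r (M ^ n)).
    by rewrite -!/(anc _ _) (core_anc yi') (core_anc zj') leq_add2l leqNgt ij.
  apply: rt_step; rewrite !ancS (core_anc yi') (core_anc zj') !sub_index // eqxx !andbT.
  by rewrite /adj ltn_eqF // /minn /maxn yz.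
have [i iM ui] := coreP uc; have [j jM vj] := coreP vc.
case: (ltngtP i j) => ij.
- exact: main ij jM ui vj.
- exact: conn_in_sym (main _ _ _ _ ij iM vj ui).
- by apply: sub iM ui _; rewrite ij.
Qed.

Definition conn_core w n x : Prop :=
  exists2 g, g \in core w n (anc n x) & conn_in w n (anc n x) x g.

Definition exits w n x z : Prop :=
  anc n z != anc n x /\ exists2 u, conn_in w n (anc n x) x u & adj w u z.

(** Taking the least exit makes the events for different [z] disjoint. *)
Definition first_exit w n x z : Prop :=
  exits w n x z /\ forall z', z' < z -> ~ exits w n x z'.

Definition good_from w n x : Prop := forall k, n <= k -> good w k (anc k x).

Definition giant w n x : Prop := conn_core w n x /\ good_from w n x.

(** Edges with an end in the [n]-ball of [x], cut off at a bound covering this ball and [z]: all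
    that the search for exits up to [z] reads. *)
Definition exit_pairs (n x z : nat) : seq (nat * nat) :=
  let b := maxn z.+1 ((anc n x).+1 * M ^ n) in
  [seq p <- allpairs pair (iota 0 b) (iota 0 b) |
     (p.1 < p.2) && ((anc n p.1 == anc n x) || (anc n p.2 == anc n x))].

Lemma mem_exit_pairs n x z u v : u < v -> u < maxn z.+1 ((anc n x).+1 * M ^ n) ->
  v < maxn z.+1 ((anc n x).+1 * M ^ n) ->
  (anc n u == anc n x) || (anc n v == anc n x) -> (u, v) \in exit_pairs n x z.
Proof.
move=> uv ub vb uvx; rewrite mem_filter /= uv uvx /=; apply/allpairsP.
by exists (u, v); rewrite !mem_iota !add0n.
Qed.

Lemma ball_exit_pairs n x z : {subset ball_pairs n (anc n x) <= exit_pairs n x z}.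
Proof.
move=> [u v]; rewrite mem_ball_pairs /= => /and3P[/eqP ux /eqP vx uv].
by apply: mem_exit_pairs; rewrite // ?ux ?eqxx // leq_max anc_lt ?orbT.
Qed.

(** Allowing every [z' <= z] lets the absence of earlier exits transfer as well. *)
Lemma exits_eq (w w' : config) n x z z' : z' <= z -> {in exit_pairs n x z, w =1 w'} ->
  exits w n x z' -> exits w' n x z'.
Proof.
move=> zz ww' [zx [u xu uz]]; split=> //; exists u.
  by apply: conn_in_eq xu => p pb; apply: ww'; exact: ball_exit_pairs.
have ux := conn_in_anc erefl xu; move: uz; rewrite /adj.
have ub := anc_lt ux.
case: eqP => //= uz; rewrite ww' //; apply: mem_exit_pairs.
- move/eqP: uz; rewrite /minn /maxn. by case: (ltngtP u z').
- by rewrite /minn; case: ifP; rewrite leq_max ?ub ?orbT // ltnS zz.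
- by rewrite /maxn; case: ifP; rewrite leq_max ?ub ?orbT // ltnS zz.
- by rewrite /minn /maxn; case: ifP; rewrite ux eqxx ?orbT.
Qed.

Lemma first_exit_eq (w w' : config) n x z : {in exit_pairs n x z, w =1 w'} ->
  first_exit w n x z -> first_exit w' n x z.
Proof.
move=> ww' [ex nex]; split; first exact: exits_eq (leqnn z) ww' ex.
move=> z' zz' ex'; apply: (nex z' zz'); apply: exits_eq (ltnW zz') _ ex'.
by move=> p /ww'.
Qed.

Lemma conn_core_eq (w w' : config) n x : {in ball_pairs n (anc n x), w =1 w'} ->
  conn_core w n x -> conn_core w' n x.
Proof.
move=> ww' [g gc xg]; exists g; first by rewrite -(core_eq ww').
exact: conn_in_eq ww' xg.
Qed.

Lemma conn_exits w n x y : conn w x y -> anc n y != anc n x ->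
  exists z, exits w n x z.
Proof.
move=> xy yx; have: conn_in w n (anc n x) x y \/ exists z, exits w n x z.
  elim/clos_refl_trans_ind_left: xy {yx} => [|y' z _ [xy'|ex] yz].
  - by left; exact: rt_refl.
  - have y'x := conn_in_anc erefl xy'.
    case: (eqVneq (anc n z) (anc n x)) => [zx|zx].
      left; apply: rt_trans xy' _; apply: rt_step; by rewrite yz y'x zx eqxx.
    by right; exists z; split=> //; exists y'.
  - by right.
by case=> // /(conn_in_anc erefl) yx'; rewrite yx' eqxx in yx.
Qed.

Lemma infinite_first_exit w n x : infinite_at w x -> exists z, first_exit w n x z.
Proof.
move=> /(_ ((anc n x).+1 * M ^ n))[y ny xy].
have [z exz] : exists z, exits w n x z.
  apply: (conn_exits xy); apply/eqP => /anc_lt; by rewrite ltnNge ny.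
have [z' /asboolP ez' minz'] : {z' | `[< exits w n x z' >] &
    forall m, `[< exits w n x m >] -> z' <= m}.
  have ex : exists z, `[< exits w n x z >] by exists z; apply/asboolP.
  by exists (ex_minn ex); case: ex_minnP.
exists z'; split=> // m mz /asboolP /minz'; by rewrite leqNgt mz.
Qed.

Lemma giant_mono w n m x : n <= m -> giant w n x -> giant w m x.
Proof.
move=> nm [[g gc xg] gd]; split; last by move=> k mk; apply: gd; exact: leq_trans mk.
exists g; last exact: conn_in_sub xg.
by apply: core_chain gc => // k /andP[nk _]; apply: gd; exact: ltnW.
Qed.

(** At a level above [n] and [m] where the two balls have merged, both vertices are connected to the
    same core, and a core is connected. *)
Lemma giant_conn w n m x y : giant w n x -> giant w m y -> conn w x y.
Proof.
move=> gx gy; have [l xy] := anc_eventually x y.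
pose k := maxn l (maxn n m).
have xyk : anc k x = anc k y by apply: anc_eq_le xy; exact: leq_maxl.
have nk : n <= k by rewrite /k !leq_max leqnn orbT.
have mk : m <= k by rewrite /k !leq_max leqnn !orbT.
have [[g gc xg] _] := giant_mono nk gx.
have [[h hc yh] _] := giant_mono mk gy.
rewrite -xyk in hc.
apply: rt_trans (conn_in_conn xg) _; apply: rt_trans (conn_in_conn (core_conn gc hc)) _.
exact/conn_sym/(conn_in_conn yh).
Qed.

(* The first vertex z discovered outside the n-ball of x carries its own
   chain of good balls, which absorbs x at the level m where the balls of x
   and z merge. *)
Lemma first_exit_giant w n m x z : n < m -> anc m z = anc m x ->
  (forall k, k < m -> good w k (anc k z)) -> good_from w n x ->
  first_exit w n x z -> giant w m x.
Proof.
move=> nm zx gz gx [[_ [u xu uz]] _]; split; last first.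
  by move=> k mk; apply: gx; exact: leq_trans (ltnW nm) mk.
exists z.
  rewrite -zx; apply: (@core_chain w 0) => //; last by rewrite anc0 inE.
  move=> k /andP[_]; rewrite leq_eqVlt => /orP[/eqP ->|]; last exact: gz.
  by rewrite zx; apply: gx; exact: ltnW.
apply: rt_trans (conn_in_sub (ltnW nm) xu) _; apply: rt_step.
by rewrite uz zx eqxx (anc_eq_le (ltnW nm) (conn_in_anc erefl xu)) eqxx.
Qed.

(** The core of level 0 is the vertex itself, so [x] lies in every core around it, and their sizes
    are unbounded. *)
Lemma good_infinite w x : 2 < M -> (forall k, good w k (anc k x)) ->
  infinite_at w x.
Proof.
move=> M2 gd n.
have xc : x \in core w n (anc n x).
  by apply: (@core_chain w 0) => //; rewrite anc0 inE.
have sz : n < size (core w n (anc n x)).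
  (* Here [2 < M] enters: [M.-1] is at least 2, so its [n]-th power exceeds [n]. *)
  apply: leq_trans (core_size (gd n)); apply: ltn_expl; lia.
have [y yc ny] : exists2 y, y \in core w n (anc n x) & n <= y.
  apply/hasP; apply/negPn/negP => /hasPn no.
  suff : size (core w n (anc n x)) <= n by rewrite leqNgt sz.
  rewrite -[X in _ <= X](size_iota 0 n); apply: uniq_leq_size; first exact: core_uniq.
  by move=> y /no; rewrite mem_iota add0n -ltnNge.
by exists y => //; exact: conn_in_conn (core_conn xc yc).
Qed.

End Hierarchy.

(** * Independence of finitely determined events *)

Section RealProbability.
Local Open Scope classical_set_scope.
Context (R : realType) (d : measure_display) (T : measurableType d)
  (P : probability T R).
Implicit Types A B C : set T.

(** Real values, unlike extended ones, are within reach of [ring], [lra] and [nra]. *)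
Definition pr A : R := fine (P A).

Lemma prE A : measurable A -> P A = (pr A)%:E.
Proof. by move=> mA; rewrite /pr fineK // fin_num_measure. Qed.

Lemma pr_ge0 A : 0 <= pr A.
Proof. exact/fine_ge0/measure_ge0. Qed.

Lemma prT : pr setT = 1.
Proof. by rewrite /pr probability_setT. Qed.

Lemma pr0 : pr set0 = 0.
Proof. by rewrite /pr measure0. Qed.

Lemma pr_mono A B : measurable A -> measurable B -> A `<=` B -> pr A <= pr B.
Proof.
move=> mA mB AB; rewrite -lee_fin -!prE //.
by apply: le_measure => //; rewrite inE.
Qed.

Lemma pr_split A C : measurable A -> measurable C ->
  pr A = pr (A `&` C) + pr (A `\` C).
Proof.
move=> mA mC; apply: EFin_inj; rewrite EFinD -!prE //.
- by rewrite (measureDI P mA mC) addeC.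
- exact: measurableD.
- exact: measurableI.
Qed.

Lemma prC A : measurable A -> pr (~` A) = 1 - pr A.
Proof.
move=> mA; have := pr_split measurableT mA.
by rewrite prT setTI setTD => ->; rewrite addrC addKr.
Qed.

Lemma prU_le A B : measurable A -> measurable B -> pr (A `|` B) <= pr A + pr B.
Proof.
move=> mA mB; rewrite -lee_fin EFinD -!prE //; first exact: measureU2.
exact: measurableU.
Qed.

Lemma pr_bigU_le (I : eqType) (s : seq I) (F : I -> set T) :
  (forall i, i \in s -> measurable (F i)) ->
  pr (\big[setU/set0]_(i <- s) F i) <= \sum_(i <- s) pr (F i).
Proof.
elim: s => [|i s IH] mF; first by rewrite !big_nil pr0.
have mF' j : j \in s -> measurable (F j) by move=> js; apply: mF; rewrite inE js orbT.
rewrite !big_cons; apply: le_trans (prU_le _ _) _.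
- by apply: mF; rewrite inE eqxx.
- by rewrite big_seq; apply: bigsetU_measurable.
- by rewrite lerD2l IH.
Qed.

Lemma pr_bigcup_mono_le (V : nat -> set T) (c : R) :
  (forall n, measurable (V n)) -> nondecreasing_seq V ->
  (forall n, pr (V n) <= c) -> pr (\bigcup_n V n) <= c.
Proof.
move=> mV ndV Vc; have mW : measurable (\bigcup_n V n) by exact: bigcupT_measurable.
rewrite -lee_fin -prE //; apply: cvge_to_le (nondecreasing_cvg_mu mV mW ndV) _.
by apply: nearW => n /=; rewrite prE // lee_fin.
Qed.

Lemma pr_bigcup_approx (V : nat -> set T) (eps : R) : 0 < eps ->
  (forall n, measurable (V n)) -> nondecreasing_seq V ->
  exists n, pr ((\bigcup_n V n) `\` V n) < eps.
Proof.
move=> eps0 mV ndV; apply: contrapT => no.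
have mW : measurable (\bigcup_n V n) by exact: bigcupT_measurable.
have : pr (\bigcup_n V n) <= pr (\bigcup_n V n) - eps.
  apply: pr_bigcup_mono_le => // n; rewrite lerBrDr (pr_split mW (mV n)).
  rewrite setIidr; last exact: bigcup_sup.
  by rewrite lerD2l leNgt; apply/negP => le; apply: no; exists n.
by rewrite lerBrDr gerDl leNgt eps0.
Qed.

Lemma pr_bigcup_le (F : nat -> set T) (c : R) : (forall n, measurable (F n)) ->
  (forall n, pr (\big[setU/set0]_(i < n) F i) <= c) -> pr (\bigcup_n F n) <= c.
Proof.
move=> mF Fc; rewrite -bigcup_bigsetU_bigcup.
apply: pr_bigcup_mono_le => [n||n]; last exact: Fc.
- by apply: bigsetU_measurable.
- apply/nondecreasing_seqP => n; rewrite subsetEset.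
  by rewrite [X in _ `<=` X]big_ord_recr /=; exact: subsetUl.
Qed.

Lemma pr_bigcup_geom (F : nat -> set T) (K a : R) : 0 <= K -> 0 < a -> a < 1 ->
  (forall n, measurable (F n)) -> (forall n, pr (F n) <= K * a ^+ n) ->
  pr (\bigcup_n F n) <= K / (1 - a).
Proof.
move=> K0 a0 a1 mF FK; apply: pr_bigcup_le => // n.
have -> : \big[setU/set0]_(i < n) F i = \big[setU/set0]_(i <- index_iota 0 n) F i.
  by rewrite big_mkord.
apply: le_trans (pr_bigU_le (fun i _ => mF i)) _.
have na : `|a| < 1 by rewrite gtr0_norm.
apply: le_trans (geometric_le_lim n K0 a0 na).
by rewrite /series /=; apply: ler_sum => i _; exact: FK.
Qed.

(** Subadditivity handles the [F n]; disjointness turns the sum over the [G n] into the measure of a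
    union. This serves both for conditioning on a value and for decomposing by the first exit. *)
Lemma pr_bigcup_compare (F G : nat -> set T) (c : R) : 0 <= c ->
  (forall n, measurable (F n)) -> (forall n, measurable (G n)) ->
  trivIset setT G -> (forall n, pr (F n) <= c * pr (G n)) ->
  pr (\bigcup_n F n) <= c * pr (\bigcup_n G n).
Proof.
move=> c0 mF mG tG FG; apply: pr_bigcup_le => // n.
have mGn : measurable (\big[setU/set0]_(i < n) G i) by apply: bigsetU_measurable.
apply: le_trans (_ : _ <= c * pr (\big[setU/set0]_(i < n) G i)) _; last first.
  apply: ler_wpM2l => //; apply: pr_mono => //; first exact: bigcupT_measurable.
  by rewrite -bigcup_mkord; apply: bigcup_subset.
have -> : pr (\big[setU/set0]_(i < n) G i) = \sum_(i < n) pr (G i).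
  apply: EFin_inj; rewrite -prE // measure_bigsetU // -sumEFin.
  by apply: eq_bigr => i _; exact: prE.
rewrite mulr_sumr.
have -> : \big[setU/set0]_(i < n) F i = \big[setU/set0]_(i <- index_iota 0 n) F i.
  by rewrite big_mkord.
apply: le_trans (pr_bigU_le (fun i _ => mF i)) _.
by rewrite big_mkord; apply: ler_sum => i _; exact: FG.
Qed.

End RealProbability.

Section FiniteDependence.
Local Open Scope classical_set_scope.
Variable I : eqType.
Implicit Types (s l : seq I) (A B : set (I -> bool)).

Definition determined s A : Prop :=
  forall f g : I -> bool, {in s, f =1 g} -> A f -> A g.

Definition slice A (i : I) (b : bool) : set (I -> bool) :=
  [set f | A (fun j => if j == i then b else f j)].

Lemma determined_sub s s' A : {subset s <= s'} -> determined s A -> determined s' A.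
Proof. by move=> ss dA f g fg; apply: dA => i /ss; exact: fg. Qed.

Lemma determined_slice i s A b : determined (i :: s) A -> determined s (slice A i b).
Proof.
move=> dA f g fg; apply: dA => j; rewrite inE.
by case: eqP => //= _; exact: fg.
Qed.

Lemma determinedI s A B : determined s A -> determined s B -> determined s (A `&` B).
Proof. by move=> dA dB f g fg [/(dA _ _ fg) Ag /(dB _ _ fg) Bg]. Qed.

Lemma determinedC s A : determined s A -> determined s (~` A).
Proof.
by move=> dA f g fg nA Ag; apply: nA; apply: dA Ag => i /fg.
Qed.

Lemma determined_nil A : determined [::] A -> A = setT \/ A = set0.
Proof.
move=> dA; have [Ax|nA] := pselect (exists f, A f).
  by left; case: Ax => f Af; apply/seteqP; split=> // g _; apply: dA Af.
by right; apply/seteqP; split=> // f Af; apply: nA; exists f.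
Qed.

End FiniteDependence.

Section Independence.
Local Open Scope classical_set_scope.
Context (R : realType) (d : measure_display) (T : measurableType d)
  (P : probability T R) (I : eqType) (V : pred I) (w : T -> I -> bool).
Hypothesis mw : forall i, measurable [set t | w t i].
Hypothesis indep : forall s, uniq s -> all V s ->
  pr P [set t | all (w t) s] = \prod_(i <- s) pr P [set t | w t i].
Implicit Types (s l : seq I) (A B : set (I -> bool)).

Definition event A : set T := [set t | A (w t)].

Lemma event_split i A : event A =
  ([set t | w t i] `&` event (slice A i true)) `|`
  (~` [set t | w t i] `&` event (slice A i false)).
Proof.
have sl t b : w t i = b -> (fun j => if j == i then b else w t j) = w t.
  by move=> wb; apply/funext => j; case: eqP => // ->.
apply/seteqP; split=> t; rewrite /event /slice /=.
  move=> At; case wi : (w t i); [left|right]; split=> //; by rewrite sl.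
case=> -[wi]; last move/negP/negbTE: wi => wi; by rewrite sl.
Qed.

Lemma measurable_event s A : determined s A -> measurable (event A).
Proof.
elim: s A => [|i s IH] A dA.
  by case: (determined_nil dA) => ->; [exact: measurableT|exact: measurable0].
have mA b : measurable (event (slice A i b)) by apply: IH; exact: determined_slice dA.
rewrite (event_split i); apply: measurableU; apply: measurableI => //.
exact: measurableC.
Qed.

(** The part where coordinate [i] is false is written as a difference, so that only positive
    coordinates appear, the only ones [indep] speaks of. *)
Lemma pr_event_split s i A (C : set T) : determined s A -> measurable C ->
  pr P (event A `&` C) =
  pr P (event (slice A i true) `&` ([set t | w t i] `&` C)) +
  pr P (event (slice A i false) `&` C) -
  pr P (event (slice A i false) `&` ([set t | w t i] `&` C)).
Proof.
move=> dA mC.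
have dA' : determined (i :: s) A.
  by apply: determined_sub dA => j js; rewrite inE js orbT.
have mA b := measurable_event (determined_slice (b := b) dA').
have mA' := measurable_event dA.
rewrite (pr_split (A := event A `&` C) P (measurableI _ _ mA' mC) (mw i)).
rewrite (pr_split (A := event (slice A i false) `&` C) P (measurableI _ _ (mA _) mC) (mw i)).
rewrite -addrA; congr (_ + _).
  congr (pr P _); rewrite {1}(event_split i A).
  by apply/seteqP; split=> t /= => [[[[[_ ?]|[? _]] ?] ?]|[? [? ?]]] //; tauto.
rewrite [X in _ = X + _ - _](_ : _ = pr P (event (slice A i false) `&`
   ([set t | w t i] `&` C))); last by congr (pr P _); rewrite -setIA (setIC C).
rewrite addrAC subrr add0r; congr (pr P _); rewrite {1}(event_split i A).
by apply/seteqP; split=> t /=; tauto.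
Qed.

(** Induction on [s] for all [l] at once: the split moves a coordinate of [s] into the cylinder,
    where [indep] evaluates it. *)
Lemma pr_event_cylinder s l A : determined s A -> all V s -> all V l -> uniq l ->
  {in s, forall i, i \notin l} ->
  pr P (event A `&` [set t | all (w t) l]) =
  pr P (event A) * pr P [set t | all (w t) l].
Proof.
have mcyl l' : measurable [set t | all (w t) l'].
  elim: l' => [|i l' IH] /=; first by rewrite (_ : mkset _ = setT) //; apply/seteqP; split.
  rewrite (_ : mkset _ = [set t | w t i] `&` [set t | all (w t) l']).
    exact: measurableI.
  by apply/seteqP; split=> t /= /andP.
elim: s l A => [|i s IH] l A dA Vs Vl ul sl.
  case: (determined_nil dA) => ->.
    by rewrite -[event setT]/(setT : set T) setTI prT mul1r.
  by rewrite -[event set0]/(set0 : set T) set0I pr0 mul0r.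
have sl' : {in s, forall j, j \notin l}.
  by move=> j js; apply: sl; rewrite inE js orbT.
move: Vs => /= /andP[Vi Vs].
have [is_|is_] := boolP (i \in s).
  apply: IH => //; apply: determined_sub dA => j.
  by rewrite inE => /orP[/eqP ->|].
have cons l' : [set t | w t i] `&` [set t | all (w t) l'] = [set t | all (w t) (i :: l')].
  by apply/seteqP; split=> t /= => [[-> ->]|/andP[]].
have dsl b := determined_slice (b := b) dA.
have IH' b l' : all V l' -> uniq l' -> {in s, forall j, j \notin l'} ->
  pr P (event (slice A i b) `&` [set t | all (w t) l']) =
  pr P (event (slice A i b)) * pr P [set t | all (w t) l'] by exact: IH.
have il : i \notin l by apply: sl; rewrite inE eqxx.
have pcons l' : i \notin l' -> uniq l' -> all V l' ->
    pr P [set t | all (w t) (i :: l')] = pr P [set t | w t i] * pr P [set t | all (w t) l'].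
  by move=> il' ul' Vl'; rewrite !indep ?big_cons //= ?il' ?ul' ?Vi ?Vl'.
have key l' : i \notin l' -> uniq l' -> all V l' -> {in s, forall j, j \notin l'} ->
    pr P (event A `&` [set t | all (w t) l']) =
    (pr P (event (slice A i true)) * pr P [set t | w t i] +
     pr P (event (slice A i false)) * (1 - pr P [set t | w t i])) *
    pr P [set t | all (w t) l'].
  move=> il' ul' Vl' sl'2; rewrite (pr_event_split i dA (mcyl l')) cons.
  have sil' : {in s, forall j, j \notin i :: l'}.
    move=> j js; rewrite inE negb_or sl'2 // andbT.
    by apply: contra is_ => /eqP <-.
  rewrite !IH' //= ?il' ?Vi //; rewrite pcons //; ring.
(* The empty cylinder identifies the bracket in [key] as the probability of [event A]. *)
rewrite key //; have := key [::] isT isT isT (fun _ _ => isT).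
rewrite (_ : [set t | all (w t) [::]] = setT); last by apply/seteqP; split.
by rewrite setIT prT mulr1 => ->.
Qed.

Lemma pr_event_bernoulli s i A : determined s A -> all V (i :: s) ->
  pr P (event A) = pr P [set t | w t i] * pr P (event (slice A i true)) +
    (1 - pr P [set t | w t i]) * pr P (event (slice A i false)).
Proof.
move=> dA Vs; pose s' := [seq j <- s | j != i].
have Vs' : all V s' by apply/allP => j; rewrite mem_filter => /andP[_ js];
  move/allP: Vs => /(_ j); rewrite inE js orbT; exact.
have ds b : determined s' (slice A i b).
  apply: determined_slice; apply: determined_sub dA => j js.
  by rewrite inE mem_filter /= js andbT; case: eqP.
have Vi : all V [:: i] by move: Vs => /= /andP[->].
have nl : {in s', forall j, j \notin [:: i]}.
  by move=> j; rewrite mem_filter inE => /andP[].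
have cyl b : pr P (event (slice A i b) `&` [set t | w t i]) =
    pr P (event (slice A i b)) * pr P [set t | w t i].
  have := pr_event_cylinder (ds b) Vs' Vi isT nl.
  rewrite (_ : [set t | all (w t) [:: i]] = [set t | w t i]) //.
  by apply/seteqP; split=> t /=; rewrite andbT.
have := pr_event_split i dA measurableT; rewrite !setIT !cyl => ->; ring.
Qed.

(** Slicing at a coordinate of [s] leaves [B] unchanged, as this coordinate is outside [s']; the
    induction hypothesis applies to the slices of [A]. *)
Lemma event_indep s s' A B : determined s A -> determined s' B ->
  all V s -> all V s' -> {in s, forall i, i \notin s'} ->
  pr P (event A `&` event B) = pr P (event A) * pr P (event B).
Proof.
elim: s A => [|i s IH] A dA dB Vs Vs' dis.
  case: (determined_nil dA) => ->.
    by rewrite -[event setT]/(setT : set T) setTI prT mul1r.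
  by rewrite -[event set0]/(set0 : set T) set0I pr0 mul0r.
have dAB : determined ((i :: s) ++ s') (A `&` B).
  apply: determinedI; [apply: determined_sub dA|apply: determined_sub dB] => j js;
  by rewrite mem_cat js ?orbT.
have Vi : V i by move: Vs => /andP[].
have Vss : all V (i :: s) by [].
rewrite -[event A `&` event B]/(event (A `&` B)).
have Vl : all V (i :: (i :: s) ++ s').
  by move: Vss; rewrite -cat_cons all_cat Vs' andbT /= => /andP[-> ->].
rewrite (pr_event_bernoulli dAB Vl) (pr_event_bernoulli (i := i) dA) /=; last first.
  by move: Vss => /= /andP[-> ->].
have slI b : slice (A `&` B) i b = slice A i b `&` B.
  have dB' f : B (fun j => if j == i then b else f j) <-> B f.
    have is_ : i \notin s' by apply: dis; rewrite inE eqxx.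
    by split; apply: dB => j js; case: eqP => // ij; rewrite -ij js in is_.
  by apply/seteqP; split=> f [? ?]; split=> //; exact/dB'.
have Vs1 : all V s by move: Vs => /andP[].
have dis' : {in s, forall j, j \notin s'}.
  by move=> j js; apply: dis; rewrite inE js orbT.
have IH' b : pr P (event (slice (A `&` B) i b)) =
    pr P (event (slice A i b)) * pr P (event B).
  by rewrite slI; apply: IH => //; exact: determined_slice.
rewrite !IH'; ring.
Qed.

Lemma pr_none_le l (q : R) : uniq l -> all V l -> 0 <= q <= 1 ->
  (forall i, i \in l -> q <= pr P [set t | w t i]) ->
  pr P (event [set f : I -> bool | ~~ has f l]) <= (1 - q) ^+ size l.
Proof.
move=> + + /andP[q0 q1]; elim: l => [|i l IH].
  by move=> _ _ _; rewrite /event /= (_ : mkset _ = setT) ?prT //; apply/seteqP; split.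
move=> /= /andP[il ul] /andP[Vi Vl] ql.
have dl : determined l [set f : I -> bool | ~~ has f l].
  by move=> f g fg /=; rewrite (eq_in_has fg).
have di : determined [:: i] [set f : I -> bool | ~~ f i].
  by move=> f g fg /=; rewrite fg // inE.
rewrite (_ : event _ = event [set f : I -> bool | ~~ f i] `&`
  event [set f : I -> bool | ~~ has f l]); last first.
  by apply/seteqP; split=> t /=; rewrite /event /= negb_or => /andP.
have Vi' : all V [:: i] by rewrite /= Vi.
rewrite (event_indep di dl) //; last by move=> j; rewrite inE => /eqP ->.
rewrite exprS; apply: ler_pM; rewrite ?pr_ge0 //.
  have -> : event [set f : I -> bool | ~~ f i] = ~` [set t | w t i].
    by apply/seteqP; split=> t /= /negP.
  by rewrite prC // lerD2l lerN2; apply: ql; rewrite inE eqxx.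
by apply: IH => // j jl; apply: ql; rewrite inE jl orbT.
Qed.

End Independence.

(** * Balls are good with high probability *)

(** A polynomial substitute for the exponential bound: for [x <= 1], induction gives
    [(1 - x)^m (1 + m x) <= 1], because [(1 - x) (1 + (m + 1) x) <= 1 + m x]. *)
Lemma bernoulli_pow_le (R : realFieldType) (x : R) (m : nat) : 0 <= x ->
  (1 - Num.min x 1) ^+ m * (m%:R * x) <= 1.
Proof.
move=> x0; have [x1|x1] := leP x 1; last first.
  by rewrite subrr expr0n; case: m => [|m] /=; rewrite ?mul0r ?mulr0 ?mul0r ler01.
have q0 : 0 <= 1 - x by rewrite subr_ge0.
suff le1 : (1 - x) ^+ m * (1 + m%:R * x) <= 1.
  apply: le_trans le1; apply: ler_wpM2l; first exact: exprn_ge0.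
  by rewrite lerDr ler01.
elim: m => [|m IH]; first by rewrite expr0 mul0r addr0 mulr1.
apply: le_trans IH; rewrite exprSr -mulrA; apply: ler_wpM2l; first exact: exprn_ge0.
have m0 : 0 <= m%:R :> R by exact: ler0n.
rewrite -natr1; nra.
Qed.

Section Conditioning.
Local Open Scope classical_set_scope.
Context (R : realType) (d : measure_display) (T : measurableType d)
  (P : probability T R) (I : eqType) (w : T -> I -> bool).
Hypothesis mw : forall i, measurable [set t | w t i].

(** Total probability over the values of [X], numbered by [pickle]; numbers that code no value give
    empty events. *)
Lemma pr_cond_le (K : countType) (s s' : seq I) (X : (I -> bool) -> K)
    (B : set (I -> bool)) (c : R) : 0 <= c ->
  (forall f g : I -> bool, {in s, f =1 g} -> X f = X g) -> determined s' B ->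
  (forall k, pr P (event w ([set f | X f = k] `&` B)) <=
             c * pr P (event w [set f | X f = k])) ->
  pr P (event w B) <= c.
Proof.
move=> c0 dX dB Bc.
have dk n : determined s [set f | pickle (X f) = n].
  by move=> f g fg /=; rewrite (dX _ _ fg).
have dkB n : determined (s ++ s') ([set f | pickle (X f) = n] `&` B).
  by apply: determinedI; [apply: determined_sub (dk n)|apply: determined_sub dB];
    move=> i; rewrite mem_cat => ->; rewrite ?orbT.
have -> : event w B = \bigcup_n event w ([set f | pickle (X f) = n] `&` B).
  by apply/seteqP; split=> [t Bt|t [n _ []]] //; exists (pickle (X (w t))).
have mF n := measurable_event mw (dkB n).
have mG n := measurable_event mw (dk n).
apply: le_trans (pr_bigcup_compare c0 mF mG _ _) _.
- by move=> i j _ _ [t [/= <- <-]].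
- move=> n; case E : (unpickle n : option K) => [k|]; last first.
    rewrite (_ : event w (_ `&` B) = set0) ?pr0 ?mulr_ge0 ?pr_ge0 //.
    by apply/seteqP; split=> // t [/= En _]; rewrite -En pickleK in E.
  have [<-|nk] := eqVneq (pickle k) n; last first.
    rewrite (_ : event w (_ `&` B) = set0) ?pr0 ?mulr_ge0 ?pr_ge0 //.
    apply/seteqP; split=> // t [/= En _]; move: E nk; rewrite -En pickleK => -[->].
    by rewrite eqxx.
  have -> : [set f | pickle (X f) = pickle k] = [set f | X f = k].
    by apply/seteqP; split=> f /= => [/(pcan_inj pickleK)|->].
  exact: Bc.
- rewrite -[leRHS]mulr1; apply: ler_wpM2l => //; rewrite -(prT P).
  by apply: pr_mono => //; exact: bigcupT_measurable.
Qed.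

End Conditioning.

(** * Recursion for the probability of a bad ball *)

Section Supercritical.
Local Open Scope classical_set_scope.
Context (R : realType) (d : measure_display) (T : measurableType d)
  (P : probability T R) (w : T -> config) (M : nat) (b C : R).
Hypothesis M_gt2 : (2 < M)%N.
Hypothesis b_gt0 : 0 < b.
Hypothesis b_le : 2 * b <= M.-1%:R ^+ 2.
Hypothesis C_ge : 16 * M%:R ^+ 4 * b <= C.
Hypothesis mw : forall p, measurable [set t | w t p].
Hypothesis indep : forall s, uniq s -> all (fun p => p.1 < p.2)%N s ->
  pr P [set t | all (w t) s] = \prod_(p <- s) pr P [set t | w t p].
Hypothesis edge_ge : forall n u v, (u < v)%N -> anc M n u = anc M n v ->
  Num.min (C / b ^+ n) 1 <= pr P [set t | w t (u, v)].

Let M_gt1 : (1 < M)%N := ltnW M_gt2.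
Let V : pred (nat * nat) := fun p => (p.1 < p.2)%N.
(** This value solves [M^2 (kappa^2 + kappa^2) = kappa / 2]: the two terms of the recursion together
    gain the factor 1/2 per level. *)
Let kappa : R := (4 * M%:R ^+ 2)^-1.

Let M_gt0 : 0 < M%:R :> R.
Proof. by rewrite ltr0n; lia. Qed.

Let kappa_gt0 : 0 < kappa.
Proof. by rewrite invr_gt0 mulr_gt0 ?exprn_gt0. Qed.

Let C_gt0 : 0 < C.
Proof. by apply: lt_le_trans C_ge; rewrite !mulr_gt0 ?exprn_gt0. Qed.

Lemma ball_pairs_valid n a : all V (ball_pairs M n a).
Proof. by apply/allP => p; rewrite mem_ball_pairs // => /and3P[]. Qed.

Lemma determined_good n a : determined (ball_pairs M n a) [set f | good M f n a].
Proof. by move=> f g fg /=; rewrite /good (core_eq M_gt1 fg). Qed.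

Arguments determined_good : clear implicits.

Definition bad n a : set T := event w (~` [set f : config | good M f n a]).

Lemma measurable_bad n a : measurable (bad n a).
Proof. exact (measurable_event mw (determinedC (determined_good n a))). Qed.

Lemma ball_pairs_disjoint n a a' : a != a' ->
  {in ball_pairs M n a, forall p, p \notin ball_pairs M n a'}.
Proof.
move=> aa' p; rewrite !mem_ball_pairs // => /and3P[/eqP -> _ _].
by rewrite (negbTE aa').
Qed.

Definition unlinked n a a' : set config :=
  [set f | [/\ good M f n a, good M f n a' &
               ~~ linked f (core M f n a) (core M f n a')]].

Lemma determined_unlinked n a a' : (a < a')%N -> (a %/ M = a' %/ M)%N ->
  determined (ball_pairs M n.+1 (a %/ M)) (unlinked n a a').
Proof.
move=> aa' eqa.
have sub c p : (c = a \/ c = a') -> p \in ball_pairs M n c ->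
    p \in ball_pairs M n.+1 (a %/ M).
  move=> ca; rewrite !mem_ball_pairs // !ancS => /and3P[/eqP -> /eqP -> ->].
  by case: ca => ->; rewrite ?eqa eqxx.
move=> f g fg; rewrite /unlinked /good /=.
rewrite (@core_eq M M_gt1 f g n a); last by move=> p pa; apply/fg/(sub a) => //; left.
rewrite (@core_eq M M_gt1 f g n a'); last by move=> p pa; apply/fg/(sub a') => //; right.
move=> [ga ga' /hasPn nl]; split=> //; apply/hasPn => u uc; apply/hasPn => v vc.
move/hasPn: (nl u uc) => /(_ v vc); rewrite fg // mem_ball_pairs //= !ancS.
rewrite (core_anc M_gt1 uc) (core_anc M_gt1 vc) eqa eqxx /= ltnNge; apply/negP => vu.
have := leq_div2r (M ^ n) vu; rewrite -!/(anc M _ _).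
by rewrite (core_anc M_gt1 uc) (core_anc M_gt1 vc) leqNgt aa'.
Qed.

(** The two cores depend on edges inside the two balls, so given them the edges in between keep
    their law. There are at least [(M-1)^(2n) >= (2 b)^n] of these, each of probability at least
    [min(C / b^(n+1), 1)], and [bernoulli_pow_le] bounds the probability that all are absent. *)
Lemma pr_unlinked n a a' : (a < a')%N -> (a %/ M = a' %/ M)%N ->
  pr P (event w (unlinked n a a')) <= b / (C * 2 ^+ n).
Proof.
move=> aa' eqa; pose l := ball_pairs M n a ++ ball_pairs M n a'.
pose X (f : config) := (core M f n a, core M f n a').
have dX f g : {in l, f =1 g} -> X f = X g.
  by move=> fg; rewrite /X; congr pair; apply: core_eq => // p pl; apply: fg;
    rewrite mem_cat pl ?orbT.
have c0 : 0 <= b / (C * 2 ^+ n).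
  by rewrite divr_ge0 ?mulr_ge0 ?exprn_ge0 // ltW.
have dU := determined_unlinked (n := n) aa' eqa.
apply: (pr_cond_le mw c0 dX dU) => -[S S'].
have empty (A : set config) : (forall f, ~ A f) ->
    pr P (event w A) <= b / (C * 2 ^+ n) * pr P (event w [set f | X f = (S, S')]).
  move=> nA; rewrite (_ : event w A = set0).
    by rewrite pr0; apply: mulr_ge0 c0 (pr_ge0 _ _).
  by apply/seteqP; split=> // t /nA.
(* One realisation with these cores gives the size bounds, the absence of repetitions and the
   location of [S] and [S']; without one the event is empty. *)
have [[f [[fS fS'] [gS gS' _]]]|no] :=
  pselect (exists f, ([set f | X f = (S, S')] `&` unlinked n a a') f);
  last by apply: empty => f Af; apply: no; exists f.
have sz := core_size M_gt1 gS; have sz' := core_size M_gt1 gS'.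
have un := core_uniq M_gt1 f n a; have un' := core_uniq M_gt1 f n a'.
rewrite fS fS' in sz sz' un un'.
have Sa u : u \in S -> anc M n u = a by rewrite -fS; exact: core_anc.
have Sa' u : u \in S' -> anc M n u = a' by rewrite -fS'; exact: core_anc.
pose L := [seq (u, v) | u <- S, v <- S'].
have uL : uniq L by apply: allpairs_uniq => // -[? ?] [? ?].
have SL u v : (u, v) \in L -> u \in S /\ v \in S'.
  by move=> /allpairsP[[u' v'] [/= ? ? [-> ->]]].
have VL : all V L.
  apply/allP => -[u v] /SL[/Sa ua /Sa' va]; rewrite /V /= ltnNge; apply/negP => vu.
  have := leq_div2r (M ^ n) vu; rewrite -!/(anc M _ _).
  by rewrite ua va leqNgt aa'.
have dXk : determined l [set f | X f = (S, S')].
  by move=> g h gh /=; rewrite (dX _ _ gh).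
have dN : determined L [set f : config | ~~ has f L].
  by move=> g h gh /=; rewrite (eq_in_has gh).
have Vl : all V l by rewrite all_cat !ball_pairs_valid.
have dis : {in l, forall p, p \notin L}.
  move=> [u v]; rewrite mem_cat => uvl; apply/negP => /SL[/Sa ua /Sa' va].
  by move: uvl; rewrite !mem_ball_pairs //= ua va !eqxx (gtn_eqF aa') (ltn_eqF aa').
apply: le_trans (_ : _ <= pr P (event w [set f | X f = (S, S')] `&`
                              event w [set f : config | ~~ has f L])) _.
  apply: pr_mono.
  - apply: measurableI; first exact (measurable_event mw dXk).
    exact (measurable_event mw dU).
  - apply: measurableI; first exact (measurable_event mw dXk).
    exact (measurable_event mw dN).
  - move=> t [Xt [_ _ nl]]; split=> //=; apply/hasPn => -[u v] /SL[uS vS].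
    have [cS cS'] := Xt; rewrite cS cS' in nl.
    by move/hasPn: nl => /(_ u uS) /hasPn /(_ v vS).
rewrite (event_indep mw indep dXk dN Vl VL dis) mulrC.
apply: ler_wpM2r; first exact: pr_ge0.
pose x := C / b ^+ n.+1; have x0 : 0 < x by rewrite divr_gt0 // exprn_gt0.
have qx : 0 <= Num.min x 1 <= 1.
  by rewrite ge_min lexx orbT andbT le_min ler01 (ltW x0).
apply: le_trans (pr_none_le mw indep uL VL qx _) _.
  move=> [u v] uvL; have [uS vS] := SL _ _ uvL; apply: edge_ge.
    by move/allP: VL => /(_ _ uvL).
  by rewrite !ancS (Sa _ uS) (Sa' _ vS).
have := bernoulli_pow_le (size L) (ltW x0).
have szL : (2 * b) ^+ n <= (size L)%:R.
  apply: le_trans (_ : (M.-1%:R ^+ 2) ^+ n <= _).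
    by apply: lerXn2r; rewrite ?nnegrE ?exprn_ge0 ?mulr_ge0 // ltW.
  rewrite -exprM mulnC exprM -!natrX ler_nat size_allpairs.
  by rewrite expnS expn1; exact: leq_mul.
have y0 : 0 < C * 2 ^+ n / b by rewrite divr_gt0 // mulr_gt0 // exprn_gt0.
have yL : C * 2 ^+ n / b <= (size L)%:R * x.
  rewrite /x; apply: le_trans (ler_wpM2r (ltW x0) szL).
  rewrite /x exprMn exprS invfM; have bn : b ^+ n != 0 by rewrite expf_neq0 // gt_eqF.
  rewrite le_eqVlt; apply/orP; left; apply/eqP; field.
  by rewrite bn gt_eqF.
move=> le1; rewrite -[leRHS]invf_div -[leRHS]mul1r ler_pdivlMr //.
apply: le_trans le1; apply: ler_wpM2l => //.
by rewrite exprn_ge0 // subr_ge0; case/andP: qx.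
Qed.

(** Induction on the level. With [r = 2^-n], two given sub-balls are both bad with probability at
    most [(kappa r)^2] by independence, and good but unlinked with probability at most [b r / C];
    there are at most [M^2] pairs. *)
Lemma pr_bad n a : pr P (bad n a) <= kappa * 2^-1 ^+ n.
Proof.
elim: n a => [|n IH] a.
  rewrite /bad (_ : event _ _ = set0) ?pr0 ?expr0 ?mulr1 ?(ltW kappa_gt0) //.
  by apply/seteqP; split=> // t; rewrite /event /=.
pose l := [seq p <- allpairs pair (iota 0 M) (iota 0 M) | (p.1 < p.2)%N].
pose c i := (a * M + i)%N.
pose F (p : nat * nat) := (bad n (c p.1) `&` bad n (c p.2)) `|`
                          event w (unlinked n (c p.1) (c p.2)).
have lP p : p \in l -> [/\ (p.1 < p.2)%N, (p.1 < M)%N & (p.2 < M)%N].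
  case: p => x y; rewrite mem_filter => /andP[p12 /allpairsP[[i j] [/= iM jM [xi yj]]]].
  by move: iM jM; rewrite -xi -yj !mem_iota !add0n /=.
have mU x y (xyM : (x %/ M = y %/ M)%N) (xy : (x < y)%N) :
    measurable (event w (unlinked n x y)).
  exact (measurable_event mw (determined_unlinked xy xyM)).
have mF p : p \in l -> measurable (F p).
  move=> /lP[p12 p1 p2]; apply: measurableU.
    by apply: measurableI; exact: measurable_bad.
  by apply: mU; rewrite /c ?ltn_add2l // !sub_index.
have sub : bad n.+1 a `<=` \big[setU/set0]_(p <- l) F p.
  move=> t nb; rewrite -bigcup_seq.
  have mem i j : (i < j)%N -> (j < M)%N -> (i, j) \in l.
    move=> ij jM; rewrite mem_filter ij /=; apply/allpairsP; exists (i, j).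
    by rewrite !mem_iota !add0n /= jM (ltn_trans ij jM).
  have [i [j [ij jM ijP]]] := core_badS M_gt1 (introN idP nb).
  exists (i, j); first exact: mem.
  by case: ijP => [[/negP bi /negP bj]|]; [left|right].
have mFs : measurable (\big[setU/set0]_(p <- l) F p).
  by rewrite big_seq; apply: bigsetU_measurable.
apply: le_trans (pr_mono P (measurable_bad _ _) mFs sub) _.
apply: le_trans (pr_bigU_le P mF) _.
pose r : R := 2^-1 ^+ n; have r0 : 0 < r by rewrite exprn_gt0.
have r1 : r <= 1 by rewrite exprn_ile1 // invf_le1 ?ler1n.
have Fle p : p \in l -> pr P (F p) <= (kappa * r) ^+ 2 + b / C * r.
  move=> pl; have [p12 p1 p2] := lP p pl.
  have c12 : (c p.1 < c p.2)%N by rewrite ltn_add2l.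
  have cM : (c p.1 %/ M = c p.2 %/ M)%N by rewrite !sub_index.
  apply: le_trans (prU_le P _ (mU _ _ cM c12)) _.
    by apply: measurableI; exact: measurable_bad.
  apply: lerD.
    rewrite (event_indep mw indep (determinedC (determined_good _ _))
      (determinedC (determined_good _ _))) ?ball_pairs_valid //; last first.
      by apply: ball_pairs_disjoint; rewrite ltn_eqF.
    by rewrite expr2; apply: ler_pM; rewrite ?pr_ge0 //; exact: IH.
  by apply: le_trans (pr_unlinked n c12 cM) _; rewrite invfM mulrA /r exprVn.
apply: le_trans (_ : _ <= \sum_(p <- l) ((kappa * r) ^+ 2 + b / C * r)) _.
  by rewrite big_seq [leRHS]big_seq; apply: ler_sum => p; exact: Fle.
rewrite big_const_seq count_predT iter_addr_0 -[leLHS]mulr_natl.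
have szl : (size l)%:R <= M%:R ^+ 2 :> R.
  rewrite -natrX ler_nat size_filter; apply: leq_trans (count_size _ _) _.
  by rewrite size_allpairs size_iota expnS expn1.
(* This is exactly what the lower bound on [C] says. *)
have bC : b / C <= kappa ^+ 2.
  rewrite ler_pdivrMr // mulrC -ler_pdivrMr ?exprn_gt0 //.
  apply: le_trans C_ge; rewrite /kappa exprVn invrK le_eqVlt; apply/orP; left.
  by apply/eqP; ring.
have k2 : M%:R ^+ 2 * kappa ^+ 2 = kappa / 4.
  by rewrite /kappa; field; rewrite gt_eqF.
have s0 : 0 <= (kappa * r) ^+ 2 + b / C * r.
  by rewrite addr_ge0 ?exprn_even_ge0 // mulr_ge0 // ?divr_ge0 // ltW.
apply: le_trans (ler_wpM2r s0 szl) _.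
apply: le_trans (_ : _ <= M%:R ^+ 2 * (kappa ^+ 2 * r + kappa ^+ 2 * r)) _.
  apply: ler_wpM2l; first exact: exprn_ge0.
  apply: lerD; last by apply: ler_wpM2r => //; exact: ltW.
  rewrite exprMn; apply: ler_wpM2l; first by rewrite exprn_even_ge0.
  by rewrite expr2 ger_pMl.
rewrite -mulrDr -/r mulrA k2 exprS -/r; lra.
Qed.

End Supercritical.

(** * The infinite cluster *)

Lemma geometric_small (R : realType) (K a eps : R) : 0 < a -> a < 1 -> 0 < eps ->
  exists N, forall n, (N <= n)%N -> K * a ^+ n < eps.
Proof.
move=> a0 a1 eps0; have na : `|a| < 1 by rewrite gtr0_norm.
have /cvgrPdist_lt /(_ eps eps0) [N _ H] := cvg_geometric K na.
exists N => n Nn; apply: le_lt_trans (ler_norm _) _.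
by have := H n Nn; rewrite /= sub0r normrN.
Qed.

(** A path is finite, so it stays in some ball; connection becomes a countable union of finitely
    determined events. *)
Lemma clos_rt_conn_in M (w : config) x y : (1 < M)%N ->
  conn w x y -> exists n, anc M n x = anc M n y /\ conn_in M w n (anc M n x) x y.
Proof.
move=> M1; elim=> [u v uv|u|u v z _ [n [un uvn]] _ [m [vm vzm]]].
- have [n uvn] := anc_eventually M1 u v; exists n; split=> //.
  by apply: rt_step; rewrite uv -uvn !eqxx.
- by exists 0%N; split=> //; exact: rt_refl.
- exists (maxn n m); have nm := leq_maxl n m; have mn := leq_maxr n m.
  have uv := anc_eq_le nm un; have vz := anc_eq_le mn vm.
  split; first by rewrite uv.
  apply: rt_trans (conn_in_sub nm uvn) _; rewrite uv; exact: conn_in_sub mn vzm.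
Qed.

(** * Measurability of connections and infinite clusters *)

Section Measurability.
Local Open Scope classical_set_scope.
Context (d : measure_display) (T : measurableType d) (w : T -> config).
Hypothesis mw : forall p, measurable [set t | w t p].

Lemma measurable_conn x y : measurable [set t | conn (w t) x y].
Proof.
rewrite (_ : mkset _ = \bigcup_n event w [set f : config |
    anc 2 n x = anc 2 n y /\ conn_in 2 f n (anc 2 n x) x y]).
  apply: bigcupT_measurable => n.
  apply: (measurable_event mw (s := ball_pairs 2 n (anc 2 n x))).
  by move=> f g fg [nxy xy]; split=> //; exact (conn_in_eq (ltnSn 1) fg xy).
apply/seteqP; split=> t /=.
  by move=> /(clos_rt_conn_in (ltnSn 1))[n xy]; exists n.
by move=> [n _ [_ /conn_in_conn]].
Qed.

Lemma measurable_infinite x : measurable [set t | infinite_at (w t) x].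
Proof.
rewrite (_ : mkset _ = \bigcap_n \bigcup_(y in [set y | (n <= y)%N])
    [set t | conn (w t) x y]).
  apply: bigcapT_measurable => n; apply: bigcup_measurable => y _.
  exact: measurable_conn.
apply/seteqP; split=> t /=.
  by move=> inf n _; have [y ny xy] := inf n; exists y.
by move=> inf n; have [y ny xy] := inf n I; exists y.
Qed.

End Measurability.

Section GiantCluster.
Local Open Scope classical_set_scope.
Context (R : realType) (d : measure_display) (T : measurableType d)
  (P : probability T R) (w : T -> config) (M : nat) (kappa : R).
Hypothesis M_gt2 : (2 < M)%N.
Hypothesis mw : forall p, measurable [set t | w t p].
Hypothesis indep : forall s, uniq s -> all (fun p => p.1 < p.2)%N s ->
  pr P [set t | all (w t) s] = \prod_(p <- s) pr P [set t | w t p].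
Hypothesis kappa_gt0 : 0 < kappa.
Hypothesis kappa_le : kappa <= 4^-1.
Hypothesis pr_bad_le : forall n a, pr P (bad w M n a) <= kappa * 2^-1 ^+ n.

Let M_gt1 : (1 < M)%N := ltnW M_gt2.

Lemma measurable_good_from n x : measurable [set t | good_from M (w t) n x].
Proof.
rewrite (_ : mkset _ = \bigcap_k ~` bad w M (n + k) (anc M (n + k) x)).
  by apply: bigcapT_measurable => k; apply: measurableC; exact: measurable_bad.
apply/seteqP; split=> t /=.
  by move=> gd k _ /= nb; apply: nb; apply: gd; exact: leq_addr.
move=> gd k nk; apply: contrapT => nb; apply: (gd (k - n)%N I).
by rewrite /bad /event /= subnKC.
Qed.

Lemma measurable_conn_core n x : measurable [set t | conn_core M (w t) n x].
Proof.
apply: (measurable_event mw (s := ball_pairs M n (anc M n x))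
  (A := [set f : config | conn_core M f n x])).
by move=> f g fg; exact: (conn_core_eq M_gt1 fg).
Qed.

Lemma measurable_giant n x : measurable [set t | giant M (w t) n x].
Proof.
exact: measurableI (measurable_conn_core n x) (measurable_good_from n x).
Qed.

Lemma pr_good_from n x :
  pr P (~` [set t | good_from M (w t) n x]) <= 2 * kappa * 2^-1 ^+ n.
Proof.
have mb k a := measurable_bad M_gt2 mw k a.
have mF k : measurable (bad w M (n + k) (anc M (n + k) x)) by [].
apply: le_trans (pr_mono P (B := \bigcup_k bad w M (n + k) (anc M (n + k) x)) _ _ _) _.
- exact/measurableC/measurable_good_from.
- exact: bigcupT_measurable.
- move=> t /= ngd; apply: contrapT => nb; apply: ngd => k nk.
  apply: contrapT => bk; apply: nb; exists (k - n)%N => //.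
  by rewrite /bad /event /= subnKC.
have K0 : 0 <= kappa * 2^-1 ^+ n by rewrite mulr_ge0 ?exprn_ge0 // ltW.
have h0 : 0 < 2^-1 :> R by rewrite invr_gt0.
have h1 : 2^-1 < 1 :> R by rewrite invf_lt1 ?ltr1n.
apply: le_trans (pr_bigcup_geom K0 h0 h1 mF _) _.
  by move=> k; rewrite -mulrA -exprD; exact: pr_bad_le.
rewrite le_eqVlt; apply/orP; left; apply/eqP.
by rewrite (_ : 1 - 2^-1 = 2^-1 :> R) ?invrK; [ring|field].
Qed.

(** All balls around [x] are good with probability at least [1 - 2 kappa >= 1/2]. *)
Lemma infinite_pos x : 0 < pr P [set t | infinite_at (w t) x].
Proof.
apply: lt_le_trans (_ : pr P [set t | good_from M (w t) 0 x] <= _); last first.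
  apply: pr_mono; [exact: measurable_good_from|exact: measurable_infinite|].
  by move=> t /= gd; apply: (good_infinite M_gt1 M_gt2) => k; exact: gd.
have := pr_good_from 0 x; rewrite prC ?expr0; last exact: measurable_good_from.
by have := kappa_le; lra.
Qed.

(** The exceptional event has probability at most [P(F) + tail <= 2 P(G) + tail <= 2 P(W \ V) + 3
    tail], where [V] is the event [giant] at level [n] and [tail] the probability that [good_from]
    fails at [n]. *)
Lemma infinite_giant x :
  pr P ([set t | infinite_at (w t) x] `\` \bigcup_n [set t | giant M (w t) n x]) = 0.
Proof.
pose W := \bigcup_n [set t | giant M (w t) n x].
have mg n : measurable [set t | giant M (w t) n x] by exact: measurable_giant.
have mW : measurable W by exact: bigcupT_measurable.
have mI := measurable_infinite mw x.
have ndg : nondecreasing_seq (fun n => [set t | giant M (w t) n x]).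
  by move=> n m nm; rewrite subsetEset => t; exact: giant_mono M_gt1 _ _ _ _ nm.
apply/eqP; rewrite eq_le pr_ge0 andbT; apply/ler_addgt0Pr => eps eps0; rewrite add0r.
(* The final bound is [2 (eps / 4) + 3 (2 kappa 2^-n)], whence [eps / 4] here and [6 kappa]
   below. *)
have e4 : 0 < eps / 4 by rewrite divr_gt0.
have [n1 n1P] := pr_bigcup_approx P e4 mg ndg; rewrite -/W in n1P.
have h0 : 0 < 2^-1 :> R by rewrite invr_gt0.
have h1 : 2^-1 < 1 :> R by rewrite invf_lt1 ?ltr1n.
have [n2 n2P] := geometric_small (6 * kappa) h0 h1 (divr_gt0 eps0 (ltr0n R 2)).
pose n := maxn n1 n2.
have WV : pr P (W `\` [set t | giant M (w t) n x]) < eps / 4.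
  apply: le_lt_trans n1P; apply: pr_mono; [exact: measurableD..|].
  move=> t [Wt ng]; split=> //; apply: contra_not ng; apply: giant_mono => //.
  exact: leq_maxl.
have tail := pr_good_from n x.
have tailn : 6 * kappa * 2^-1 ^+ n < eps / 2 by apply: n2P; exact: leq_maxr.
have mgf := measurable_good_from n x.
(* [m z] is the level at which the balls of [z] and [x] merge. *)
have /choice[m mP] : forall z, exists k, anc M k z = anc M k x /\
    forall j, (j < k)%N -> anc M j z != anc M j x.
  move=> z.
  have ex : exists k, anc M k z == anc M k x.
    by have [k zx] := anc_eventually M_gt1 z x; exists k; apply/eqP.
  exists (ex_minn ex); case: ex_minnP => k /eqP zx min; split=> // j jk.
  by apply/negP => /min; rewrite leqNgt jk.
(* [B z] stops below the merging level; from there on the balls of [z] are those of [x], which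
   [good_from] controls. *)
pose A z : set config := [set f | ~ conn_core M f n x /\ first_exit M f n x z].
pose B z : set config := [set f | forall k, (k < m z)%N -> good M f k (anc M k z)].
have dA z : determined (exit_pairs M n x z) (A z).
  move=> f g fg [nc fe]; split; last exact: (first_exit_eq M_gt1 fg fe).
  apply: contra_not nc; apply: (conn_core_eq M_gt1) => p pb; rewrite fg //.
  exact: (ball_exit_pairs M_gt1).
have dB z : determined (ball_pairs M (m z).-1 (anc M (m z).-1 z)) (B z).
  move=> f g fg Bf k km; have := Bf k km; rewrite /good (core_eq M_gt1 (w' := g)) //.
  move=> p; rewrite mem_ball_pairs // => /and3P[/eqP p1 /eqP p2 p12]; apply: fg.
  have km1 : (k <= (m z).-1)%N by case: (m z) km.
  rewrite mem_ball_pairs // p12 andbT.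
  by rewrite (anc_eq_le km1 p1) (anc_eq_le km1 p2) !eqxx.
have mA z := measurable_event mw (dA z).
have mB z := measurable_event mw (dB z).
have AB z : pr P (event w (A z)) <= 2 * pr P (event w (A z) `&` event w (B z)).
  have [zx|zx] := eqVneq (anc M n z) (anc M n x).
    rewrite (_ : event w (A z) = set0); first by rewrite set0I pr0 mulr0.
    by apply/seteqP; split=> // t [_ [[]]]; rewrite zx eqxx.
  have [mzx mmin] := mP z.
  have nm : (n < m z)%N.
    rewrite ltnNge; apply/negP => le; case/eqP: zx; exact: anc_eq_le le mzx.
  have m1 : ((m z).-1 < m z)%N by case: (m z) nm.
  have n_m1 : (n <= (m z).-1)%N by case: (m z) nm.
  rewrite (event_indep mw indep (dA z) (dB z)).
  (* The bounds for the bad balls around [z] sum to [2 kappa <= 1/2]. *)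
  - suff half : 2^-1 <= pr P (event w (B z)).
      by have := pr_ge0 P (event w (A z)); nra.
    suff : pr P (~` event w (B z)) <= 2 * kappa by rewrite prC //; have := kappa_le; lra.
    have mb k a := measurable_bad M_gt2 mw k a.
    have mF k : measurable (bad w M k (anc M k z)) by [].
    apply: le_trans (pr_mono P (B := \bigcup_k bad w M k (anc M k z)) _ _ _) _.
    + exact: measurableC.
    + exact: bigcupT_measurable.
    + move=> t /= nB; apply: contrapT => nb; apply: nB => k km.
      by apply: contrapT => bk; apply: nb; exists k.
    apply: le_trans (pr_bigcup_geom (ltW kappa_gt0) h0 h1 mF _) _ => //.
    by rewrite (_ : 1 - 2^-1 = 2^-1 :> R) ?invrK; [rewrite mulrC|field].
  - by apply/allP => p; rewrite mem_filter => /andP[/andP[]].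
  - exact: ball_pairs_valid.
  (* An edge read by both events would have an end in the [n]-ball of [x] and in the ball of [z]
     just below the merging level; the balls would then have merged earlier. *)
  - move=> p; rewrite mem_filter mem_ball_pairs // => /andP[/andP[_ pB] _].
    have := mmin _ m1; apply: contraNN => /and3P[/eqP p1 /eqP p2 _].
    by case/orP: pB => /eqP /(anc_eq_le n_m1) <-; rewrite ?p1 ?p2.
pose F := \bigcup_z event w (A z).
pose G := \bigcup_z (event w (A z) `&` event w (B z)).
have mF : measurable F by exact: bigcupT_measurable.
have mABz z : measurable (event w (A z) `&` event w (B z)) by exact: measurableI.
have mG : measurable G by exact: bigcupT_measurable.
have FG : pr P F <= 2 * pr P G.
  apply: pr_bigcup_compare => //.
  move=> z z' _ _ [t [[[_ [ez nz]] _] [[_ [ez' nz']] _]]].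
  have [zz'|zz'|//] := ltngtP z z'; [case: (nz' _ zz')|case: (nz _ zz')]; done.
(* If [good_from] holds at [n], the good balls around [z] make [x] giant at level [m z], though it
   is not giant at level [n]. *)
have GW : G `<=` (W `\` [set t | giant M (w t) n x]) `|`
                 ~` [set t | good_from M (w t) n x].
  move=> t [z _ [[nc fe] Bt]].
  have [gf|] := pselect (good_from M (w t) n x); last by right.
  left; split; last by move=> [].
  have [mzx mmin] := mP z; exists (m z) => //.
  apply: (first_exit_giant M_gt1 _ mzx Bt gf fe).
  rewrite ltnNge; apply/negP => le; case: fe => -[/eqP zx _] _; apply: zx.
  exact: anc_eq_le le mzx.
have IF : [set t | infinite_at (w t) x] `\` W `<=`
    F `|` ~` [set t | good_from M (w t) n x].
  move=> t [inf nW]; have [gf|] := pselect (good_from M (w t) n x); last by right.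
  left; have [z fe] := infinite_first_exit M_gt1 n inf; exists z => //.
  by split=> // cc; apply: nW; exists n.
have mCg : measurable (~` [set t | good_from M (w t) n x]) by exact: measurableC.
have mD : measurable (W `\` [set t | giant M (w t) n x]) by exact: measurableD.
have le1 := pr_mono P mG (measurableU _ _ mD mCg) GW.
have le2 := pr_mono P (measurableD mI mW) (measurableU _ _ mF mCg) IF.
have le3 := prU_le P mD mCg.
have le4 := prU_le P mF mCg.
by rewrite -/W; lra.
Qed.

(** Off the countably many null events [D x], every vertex of an infinite cluster is giant at some
    level, and [giant_conn] joins any two. *)
Lemma pr_unique :
  P [set t | forall x y, infinite_at (w t) x -> infinite_at (w t) y ->
                         conn (w t) x y] = 1%E.
Proof.
set U := mkset _.
pose D x := [set t | infinite_at (w t) x] `\` \bigcup_n [set t | giant M (w t) n x].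
have mD x : measurable (D x).
  apply: measurableD; first exact: measurable_infinite.
  by apply: bigcupT_measurable => n; exact: measurable_giant.
have mU : measurable U.
  rewrite (_ : U = \bigcap_x \bigcap_y ((~` [set t | infinite_at (w t) x] `|`
    ~` [set t | infinite_at (w t) y]) `|` [set t | conn (w t) x y])).
    do 2 apply: bigcapT_measurable => ?.
    apply: measurableU; last exact: measurable_conn.
    by apply: measurableU; apply: measurableC; exact: measurable_infinite.
  apply/seteqP; split=> t /= Ut.
    move=> x _ y _; have [ix|] := pselect (infinite_at (w t) x); last by left; left.
    have [iy|] := pselect (infinite_at (w t) y); last by left; right.
    by right; exact: Ut.
  by move=> x y ix iy; have [[]|] := Ut x I y I.
have CU : ~` U `<=` \bigcup_x D x.
  move=> t nU; apply: contrapT => nD; apply: nU => x y ix iy.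
  have g z : infinite_at (w t) z -> exists n, giant M (w t) n z.
    move=> iz; apply: contrapT => ng; apply: nD; exists z => //; split=> //.
    by move=> [n _ gn]; apply: ng; exists n.
  have [n gx] := g x ix; have [k gy] := g y iy.
  exact: (giant_conn M_gt1 gx gy).
have D0 : pr P (\bigcup_x D x) <= 0.
  apply: pr_bigcup_le => // n.
  have -> : \big[setU/set0]_(i < n) D i = \big[setU/set0]_(i <- index_iota 0 n) D i.
    by rewrite big_mkord.
  apply: le_trans (pr_bigU_le P (fun i _ => mD i)) _.
  by rewrite big1 // => i _; exact: infinite_giant.
rewrite prE //; congr (_%:E); apply/eqP; rewrite eq_le; apply/andP; split.
  by rewrite -(prT P); apply: pr_mono.
have := pr_mono P (measurableC mU) (bigcupT_measurable _ mD) CU.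
by rewrite prC //; lra.
Qed.

End GiantCluster.

(** * Absence of percolation *)

Section Subcritical.
Local Open Scope classical_set_scope.
Context (R : realType) (d : measure_display) (T : measurableType d)
  (P : probability T R) (w : T -> config) (N : nat) (b K : R).
Hypothesis N_gt1 : (1 < N)%N.
Hypothesis K_ge0 : 0 <= K.
Hypothesis b_gt : N%:R ^+ 2 < b.
Hypothesis mw : forall p, measurable [set t | w t p].
Hypothesis edge_le : forall k u v, (u < v)%N ->
  anc N k.+1 u = anc N k.+1 v -> anc N k u != anc N k v ->
  pr P [set t | w t (u, v)] <= K / b ^+ k.+1.

(** Leaving the [k]-ball of 0 takes an edge to some [z] with [N^(k+i) <= z < N^(k+i+1)]. There are
    at most [N^k N^(k+i+1)] such edges, each of probability at most [K / b^(k+i+1)]; the sum over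
    [i] is geometric of ratio [N / b]. *)
Lemma pr_infinite_le k : pr P [set t | infinite_at (w t) 0] <=
  K * (N%:R / b) / (1 - N%:R / b) * (N%:R ^+ 2 / b) ^+ k.
Proof.
have N1 : 1 < N%:R :> R by rewrite ltr1n.
have b0 : 0 < b by apply: lt_trans b_gt; nra.
have a0 : 0 < N%:R / b by rewrite divr_gt0 //; lra.
have a1 : N%:R / b < 1 by rewrite ltr_pdivrMr // mul1r; apply: lt_trans b_gt; nra.
have anc_small m u : (u < N ^ m)%N -> anc N m u = 0%N by move=> ?; rewrite /anc divn_small.
pose l i := [seq p <- allpairs pair (iota 0 (N ^ k)) (iota 0 (N ^ (k + i).+1)) |
              (N ^ (k + i) <= p.2)%N].
have lP i p : p \in l i -> [/\ (p.1 < N ^ k)%N, (p.2 < N ^ (k + i).+1)%N &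
    (N ^ (k + i) <= p.2)%N].
  case: p => x y; rewrite mem_filter => /andP[p12 /allpairsP[[x' y'] [/= xM yM [xx yy]]]].
  by move: xM yM; rewrite !mem_iota !add0n -xx -yy.
pose F i := \big[setU/set0]_(p <- l i) [set t | w t p].
have mF i : measurable (F i) by rewrite /F big_seq; apply: bigsetU_measurable.
have sub : [set t | infinite_at (w t) 0] `<=` \bigcup_i F i.
  move=> t inf; have [z [[zx [u xu uz]] _]] := infinite_first_exit N_gt1 k inf.
  have u0 := conn_in_anc erefl xu.
  have anc00 : anc N k 0 = 0%N by rewrite /anc div0n.
  rewrite anc00 in zx u0.
  have uk : (u < N ^ k)%N by have := anc_lt N_gt1 u0; rewrite mul1n.
  have zk : (N ^ k <= z)%N.
    by rewrite leqNgt; apply: contra zx => zk; rewrite anc_small.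
  have uzlt := leq_trans uk zk.
  have z0 : (0 < z)%N by case: (z) uzlt.
  have tl : (N ^ trunc_log N z <= z < N ^ (trunc_log N z).+1)%N by exact: trunc_log_bounds.
  have kl : (k <= trunc_log N z)%N by apply: trunc_log_max.
  (* [trunc_log N z] is the exponent of the leading base-[N] digit of [z]. *)
  exists (trunc_log N z - k)%N => //; rewrite /F -bigcup_seq; exists (u, z).
    rewrite /= mem_filter /= subnKC //; case/andP: tl => -> zl /=.
    by apply/allpairsP; exists (u, z); rewrite !mem_iota !add0n.
  by move: uz; rewrite /adj ltn_eqF //= /minn /maxn uzlt.
have pF i : pr P (F i) <= (K * N%:R ^+ k * (N%:R / b) ^+ k.+1) * (N%:R / b) ^+ i.
  apply: le_trans (pr_bigU_le P (fun p _ => mw p)) _.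
  apply: le_trans (_ : _ <= \sum_(p <- l i) K / b ^+ (k + i).+1) _.
    rewrite big_seq [leRHS]big_seq; apply: ler_sum => -[u v] /lP[/= uk v1 v2].
    have kki : (N ^ k <= N ^ (k + i))%N by rewrite leq_exp2l // leq_addr.
    have uki := leq_trans uk kki.
    apply: edge_le; first exact: leq_trans uki v2.
      rewrite !anc_small //; apply: leq_trans uki _; by rewrite leq_exp2l.
    rewrite (anc_small _ _ uki) eq_sym -lt0n /anc divn_gt0 //.
    by rewrite expn_gt0 (ltnW N_gt1).
  rewrite big_const_seq count_predT iter_addr_0 -[leLHS]mulr_natl.
  have szl : (size (l i))%:R <= N%:R ^+ k * N%:R ^+ (k + i).+1 :> R.
    rewrite -!natrX -natrM ler_nat size_filter; apply: leq_trans (count_size _ _) _.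
    by rewrite size_allpairs !size_iota.
  have Kb : 0 <= K / b ^+ (k + i).+1 by rewrite divr_ge0 ?exprn_ge0 // ltW.
  apply: le_trans (ler_wpM2r Kb szl) _; rewrite le_eqVlt; apply/orP; left; apply/eqP.
  rewrite -[in RHS]mulrA -[in RHS]exprD addSn [in RHS]expr_div_n; ring.
have K0 : 0 <= K * N%:R ^+ k * (N%:R / b) ^+ k.+1.
  by rewrite !mulr_ge0 ?exprn_ge0 // ltW.
apply: le_trans (pr_mono P (measurable_infinite mw 0) (bigcupT_measurable _ mF) sub) _.
apply: le_trans (pr_bigcup_geom K0 a0 a1 mF pF) _.
rewrite le_eqVlt; apply/orP; left; apply/eqP.
have -> : N%:R ^+ 2 / b = N%:R * (N%:R / b) by rewrite mulrA expr2.
by move: (N%:R / b) => a; rewrite exprS exprMn; ring.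
Qed.

Lemma infinite_null : pr P [set t | infinite_at (w t) 0] = 0.
Proof.
have N1 : 1 < N%:R :> R by rewrite ltr1n.
have b0 : 0 < b by apply: lt_trans b_gt; nra.
have r0 : 0 < N%:R ^+ 2 / b by rewrite divr_gt0 // exprn_gt0; lra.
have r1 : N%:R ^+ 2 / b < 1 by rewrite ltr_pdivrMr // mul1r.
apply/eqP; rewrite eq_le pr_ge0 andbT; apply/ler_addgt0Pr => eps eps0; rewrite add0r.
have [k kP] := geometric_small (K * (N%:R / b) / (1 - N%:R / b)) r0 r1 eps0.
exact: le_trans (pr_infinite_le k) (ltW (kP k (leqnn k))).
Qed.

End Subcritical.

(** * Base-N coding of Omega_N *)

Lemma digits_exist (N n : nat) (f : nat -> nat) : (0 < N)%N ->
  (forall i, (f i < N)%N) -> (forall i, (n <= i)%N -> f i = 0%N) ->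
  exists m, forall i, (m %/ N ^ i %% N)%N = f i.
Proof.
move=> N0; elim: n f => [|n IH] f fN f0.
  by exists 0%N => i; rewrite div0n mod0n f0.
have [m mP] := IH (fun i => f i.+1) (fun i => fN i.+1) (fun i ni => f0 i.+1 ni).
exists (m * N + f 0)%N => -[|i].
  by rewrite expn0 divn1 modnMDl modn_small.
by rewrite expnS divnMA divnMDl // (divn_small (fN 0)) addn0 mP.
Qed.

Section Coding.
Variable N : nat.
Hypothesis N_gt1 : (1 < N)%N.

Definition digit (n i : nat) : nat :=
  if i is j.+1 then (anc N j n %% N)%N else 0%N.

Lemma digit_proof n : (forall i, (digit n i < N)%N) /\ digit n 0 = 0%N /\
  exists k, forall i, (k < i)%N -> digit n i = 0%N.
Proof.
split; first by move=> [|i] /=; rewrite ?ltn_mod (ltnW N_gt1).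
split=> //; exists n => -[//|i] /=; rewrite ltnS => ni.
by rewrite /anc divn_small ?mod0n // (leq_ltn_trans ni) // ltn_expl.
Qed.

(* [x_i] is the [i]-th base-[N] digit of the code of [x], counted from the
   units digit [x_1]; thus [d x y <= k] when the codes agree after division by
   [N ^ k]. *)
Definition code (n : nat) : Omega N := exist _ (digit n) (digit_proof n).

Lemma code_surj x : exists n, code n = x.
Proof.
case: x => x xP; have [xN [x0 [k xk]]] := xP.
have [m mP] := digits_exist (ltnW N_gt1) (fun i => xN i.+1) (fun i ki => xk i.+1 ki).
exists m; apply: eq_exist; apply/funext => -[|i] /=; [by rewrite x0|exact: mP].
Qed.

(** The quotients by [N^k] differ but agree after one more division by [N], so they differ in their
    last digit, which is coordinate [k.+1]. *)
Lemma code_hdist k u v : anc N k.+1 u = anc N k.+1 v -> anc N k u != anc N k v ->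
  is_hdist (code u) (code v) k.+1.
Proof.
move=> eqS neq; split=> /=.
  move=> eqm; case/eqP: neq.
  by rewrite (divn_eq (anc N k u) N) (divn_eq (anc N k v) N) eqm -!ancS eqS.
by move=> [|i] //=; rewrite ltnS => ki; rewrite (anc_eq_le ki eqS).
Qed.

Lemma merge_exists u v : u != v ->
  exists2 k, anc N k.+1 u = anc N k.+1 v & anc N k u != anc N k v.
Proof.
move=> uv; have ex : exists k, anc N k u == anc N k v.
  by have [k /eqP] := anc_eventually N_gt1 u v; exists k.
case: (ex_minnP ex) => -[|k] /eqP kP min; first by rewrite !anc0 in kP; rewrite kP eqxx in uv.
by exists k => //; apply/negP => /min; rewrite ltnn.
Qed.

Lemma code_inj : injective code.
Proof.
move=> u v uv; apply/eqP; apply/negPn/negP => /merge_exists[k eqS neq].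
by have [] := code_hdist eqS neq; rewrite uv.
Qed.

End Coding.

Lemma In_map (I : eqType) (J : Type) (f : I -> J) (s : seq I) (y : J) :
  List.In y (map f s) <-> exists2 x, x \in s & y = f x.
Proof.
elim: s => [|x s IH] /=; first by split=> // -[].
split=> [[<-|/IH[z zs ->]]|[z]].
- by exists x; rewrite ?mem_head.
- by exists z; rewrite ?inE ?zs ?orbT.
- by rewrite inE => /orP[/eqP -> ->|zs yz]; [left|right; apply/IH; exists z].
Qed.

Lemma NoDup_map (I : eqType) (J : Type) (f : I -> J) (s : seq I) :
  injective f -> uniq s -> List.NoDup (map f s).
Proof.
move=> fI; elim: s => [|x s IH] /=; first by constructor.
move=> /andP[xs us]; constructor; last exact: IH.
by move=> /In_map[z zs /fI xz]; rewrite xz zs in xs.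
Qed.

(** * Passage from the model on [Omega N] to configurations on the integers *)

Section Transfer.
Local Open Scope classical_set_scope.
Context (N : nat) (R : realType) (delta : R) (c : nat -> R)
  (d : measure_display) (T : measurableType d) (P : probability T R)
  (E : Omega N -> Omega N -> T -> bool).
Hypothesis N_gt1 : (1 < N)%N.
Hypothesis model : GN_model delta c P E.

Definition edges (t : T) : config := fun p => E (code N_gt1 p.1) (code N_gt1 p.2) t.

Lemma measurable_edges p : measurable [set t | edges t p].
Proof. by case: model => mE _ _ _; exact: mE. Qed.

(** The order [u < v] meets the side conditions of the model: no loop, and no edge listed in both
    orientations. *)
Lemma edges_indep (s : seq (nat * nat)) : uniq s ->
  all (fun p => p.1 < p.2)%N s ->
  pr P [set t | all (edges t) s] = \prod_(p <- s) pr P [set t | edges t p].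
Proof.
move=> us Vs; case: model => _ _ _ indepE.
pose f (p : nat * nat) := (code N_gt1 p.1, code N_gt1 p.2).
have fI : injective f.
  move=> [u v] [u' v'] uv.
  by have /code_inj /= -> := congr1 fst uv; have /code_inj /= -> := congr1 snd uv.
have Vlt p : p \in s -> (p.1 < p.2)%N by move/allP: Vs; exact.
have := indepE (map f s) (NoDup_map fI us).
rewrite (_ : [set t | forall p, List.In p (map f s) -> E p.1 p.2 t] =
  [set t | all (edges t) s]); last first.
  apply/seteqP; split=> t /=.
    by move=> all_s; apply/allP => p ps; apply: (all_s (f p)); apply/In_map; exists p.
  by move=> /allP all_s p /In_map[q qs ->]; exact: all_s.
move=> prE'; rewrite [LHS]/pr prE'.
- rewrite big_map; under eq_bigr do rewrite (prE P (measurable_edges _)).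
  by rewrite prodEFin.
- by move=> p /In_map[q /Vlt qs ->] /= /code_inj q12; rewrite q12 ltnn in qs.
- move=> p q /In_map[p' /Vlt ps ->] /In_map[q' /Vlt qs ->] /=.
  move=> /code_inj pq /code_inj qp.
  by move: ps; rewrite pq qp ltnNge (ltnW qs).
Qed.

Lemma pr_edge k u v : anc N k.+1 u = anc N k.+1 v -> anc N k u != anc N k v ->
  pr P [set t | edges t (u, v)] =
  Num.min (c k.+1 / (N%:R `^ (1 + delta)) ^+ k.+1) 1.
Proof.
move=> eqS neq; case: model => _ _ pE _.
rewrite /pr (pE _ _ k.+1); last exact: code_hdist.
  by rewrite (mulrC k.+1%:R) powRrM powR_mulrn ?powR_ge0.
by move=> /code_inj /= uv; rewrite uv eqxx in neq.
Qed.

Lemma connectedE t u v :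
  Defs.connected E t (code N_gt1 u) (code N_gt1 v) <-> conn (edges t) u v.
Proof.
case: model => _ symE _ _.
have adjE a b : adj (edges t) a b = (a != b) && E (code N_gt1 a) (code N_gt1 b) t.
  rewrite /adj /edges /= /minn /maxn; case: (ltngtP a b) => //= _; exact: symE.
split.
  suff H x y : Defs.connected E t x y -> forall a b, code N_gt1 a = x ->
      code N_gt1 b = y -> conn (edges t) a b by move=> /H; apply.
  elim=> [{}x {}y xy a b ax by_|{}x a b <- /code_inj ->|].
  (* [E] may contain loops, which [adj] discards; reflexivity replaces them. *)
  - have [->|ab] := eqVneq a b; first exact: rt_refl.
    by apply: rt_step; rewrite adjE ab ax by_.
  - exact: rt_refl.
  - move=> x' y' z _ xy _ yz a b ax bz; have [m my] := code_surj N_gt1 y'.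
    exact: rt_trans (xy _ _ ax my) (yz _ _ my bz).
elim=> [a b|a|a b e _ ab _ be].
- by rewrite adjE => /andP[_ ab]; exact: rt_step.
- exact: rt_refl.
- exact: rt_trans ab be.
Qed.

Lemma in_infinite_clusterE t u :
  in_infinite_cluster E t (code N_gt1 u) <-> infinite_at (edges t) u.
Proof.
have clE : Defs.cluster E t (code N_gt1 u) = code N_gt1 @` [set v | conn (edges t) u v].
  apply/seteqP; split=> [y|_ [v uv <-]]; last exact/connectedE.
  by have [v <-] := code_surj N_gt1 y; move=> /connectedE uv; exists v.
rewrite /in_infinite_cluster clE; split=> [inf n|inf].
  apply: contrapT => no; apply: inf; apply: finite_image.
  apply: (@sub_finite_set _ _ `I_n) => // v uv /=; rewrite ltnNge.
  by apply/negP => nv; apply: no; exists v.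
(* [dec] inverts [code]: a finite cluster would decode to a finite list, while the cluster has a
   vertex beyond its maximum. *)
have [dec decK] := choice (code_surj N_gt1).
move=> /(finite_image dec) /finite_seqP[s sE]; have [v sv uv] := inf (\max_(i <- s) i).+1.
have vs : [set` s] v.
  rewrite -sE; exists (code N_gt1 v); first by exists v.
  by apply: (@code_inj N N_gt1); exact: (decK (code N_gt1 v)).
by have := leq_bigmax_seq (P := xpredT) (F := id) v vs isT; rewrite leqNgt sv.
Qed.

End Transfer.

Lemma powR_lt (R : realType) (x r s : R) : 1 < x -> r < s -> x `^ r < x `^ s.
Proof.
move=> x1 rs; have x0 : x != 0 by rewrite gt_eqF // (lt_trans ltr01).
by rewrite /powR (negbTE x0) ltr_expR ltr_pM2r // ln_gt0.
Qed.

(** Passing to base [N ^ L] groups [L] levels into one without recoding the vertices. *)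
Lemma anc_expn N L n x : anc (N ^ L) n x = anc N (L * n) x.
Proof. by rewrite /anc expnM. Qed.

(** * The two regimes for the model *)

Section Transferred.
Local Open Scope classical_set_scope.
Context (N : nat) (R : realType) (delta : R) (c : nat -> R)
  (d : measure_display) (T : measurableType d) (P : probability T R)
  (E : Omega N -> Omega N -> T -> bool).
Hypothesis N_gt1 : (1 < N)%N.
Hypothesis model : GN_model delta c P E.

Let N1 : 1 < N%:R :> R. Proof. by rewrite ltr1n. Qed.

Lemma zero_code : Defs.zero (ltnW N_gt1) = code N_gt1 0.
Proof.
apply: eq_exist; apply/funext => -[//|i] /=; by rewrite /anc div0n mod0n.
Qed.

Lemma percolatesE : percolates (ltnW N_gt1) P E <->
  0 < pr P [set t | infinite_at (edges E N_gt1 t) 0].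
Proof.
rewrite /percolates zero_code (_ : [set t | _] = [set t | infinite_at (edges E N_gt1 t) 0]).
  rewrite prE ?lte_fin //; exact: measurable_infinite (measurable_edges N_gt1 model) 0.
by apply/seteqP; split=> t /(in_infinite_clusterE N_gt1 model).
Qed.

Lemma unique_infinite_clusterE : unique_infinite_cluster P E <->
  P [set t | forall x y, infinite_at (edges E N_gt1 t) x ->
       infinite_at (edges E N_gt1 t) y -> conn (edges E N_gt1 t) x y] = 1%E.
Proof.
rewrite /unique_infinite_cluster; set A := mkset _; set B := mkset _.
suff -> : A = B by [].
apply/seteqP; split=> t.
  move=> At x y /(in_infinite_clusterE N_gt1 model) ix
    /(in_infinite_clusterE N_gt1 model) iy.
  by apply/(connectedE N_gt1 model); exact: At.
move=> Bt x y; have [u <-] := code_surj N_gt1 x; have [v <-] := code_surj N_gt1 y.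
move=> /(in_infinite_clusterE N_gt1 model) ix /(in_infinite_clusterE N_gt1 model) iy.
by apply/(connectedE N_gt1 model); exact: Bt.
Qed.

Lemma no_percolation : 1 < delta -> (forall k, (0 < k)%N -> 0 < c k) ->
  (exists K, forall k, (0 < k)%N -> c k <= K) -> ~ percolates (ltnW N_gt1) P E.
Proof.
move=> delta1 c0 [K cK] /percolatesE; set b := N%:R `^ (1 + delta).
have b0 : 0 < b by rewrite powR_gt0 // (lt_trans ltr01).
have K0 : 0 <= K by apply: le_trans (cK 1%N isT); exact/ltW/c0.
have b2 : N%:R ^+ 2 < b.
  by rewrite -powR_mulrn ?ler0n //; apply: powR_lt => //; lra.
rewrite (infinite_null N_gt1 K0 b2 (measurable_edges N_gt1 model)) ?ltxx //.
move=> k u v _ eqS neq; rewrite (pr_edge N_gt1 model eqS neq) ge_min -/b.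
by rewrite ler_pM2r ?invr_gt0 ?exprn_gt0 // cK.
Qed.

Lemma percolation L : -1 < delta -> (1 < L)%N ->
  8 * (N%:R `^ (1 + delta) / N%:R ^+ 2) ^+ L < 1 ->
  (forall k, (0 < k)%N -> 16 * (N ^ L)%:R ^+ 4 * (N%:R `^ (1 + delta)) ^+ L <= c k) ->
  percolates (ltnW N_gt1) P E /\ unique_infinite_cluster P E.
Proof.
set b := N%:R `^ (1 + delta); set M := (N ^ L)%N.
move=> delta0 L1 bL cC; have b1 : 1 < b.
  by rewrite -(powRr0 N%:R); apply: powR_lt => //; lra.
have b0 : 0 < b by apply: lt_trans b1.
(* [1 < L] is what secures this when [N = 2]. *)
have M2 : (2 < M)%N.
  apply: (@leq_trans (N ^ 2)); last by rewrite leq_exp2l.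
  by apply: leq_trans (_ : 2 ^ 2 <= _)%N => //; rewrite leq_exp2r.
have bM0 : 0 < b ^+ L by rewrite exprn_gt0.
(* [8 b^L <= M^2] and [M - 1 >= M / 2] give [(M - 1)^2 >= M^2 / 4 >= 2 b^L]. *)
have bM : 2 * b ^+ L <= M.-1%:R ^+ 2.
  have MM : M%:R / 2 <= M.-1%:R :> R.
    by rewrite ler_pdivrMr // -natrM ler_nat; lia.
  have M2r : 8 * b ^+ L <= M%:R ^+ 2.
    rewrite /M natrX exprAC.
    have N0 : 0 < (N%:R ^+ 2) ^+ L :> R by rewrite !exprn_gt0 // (lt_trans ltr01).
    by have := ltW bL; rewrite expr_div_n mulrA ler_pdivrMr // mul1r.
  have M0 : 0 <= M%:R :> R by exact: ler0n.
  nra.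
have mw := measurable_edges N_gt1 model.
have edge_ge n u v : (u < v)%N -> anc M n u = anc M n v ->
    Num.min (16 * M%:R ^+ 4 * b ^+ L / (b ^+ L) ^+ n) 1 <=
    pr P [set t | edges E N_gt1 t (u, v)].
  move=> uv; rewrite !anc_expn => uvn.
  have [k eqS neq] := merge_exists N_gt1 (negbT (ltn_eqF uv)).
  rewrite (pr_edge N_gt1 model eqS neq) -/b; apply: le_min2 => //.
  (* The distance [k.+1] is at most [L * n]; as [b > 1], replacing it by [L * n] only lowers the
     bound. *)
  have kn : (k.+1 <= L * n)%N.
    rewrite ltnNge; apply/negP => le; case/eqP: neq; exact: anc_eq_le le uvn.
  rewrite -exprM; apply: ler_pM.
  - by rewrite !mulr_ge0 ?exprn_ge0 // ltW.
  - by rewrite invr_ge0 exprn_ge0 // ltW.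
  - exact: cC.
  - by rewrite lef_pV2 ?posrE ?exprn_gt0 // ler_weXn2l // ltW.
have kappa0 : 0 < (4 * M%:R ^+ 2)^-1 :> R.
  by rewrite invr_gt0 mulr_gt0 ?exprn_gt0 // ltr0n; lia.
have kappa4 : (4 * M%:R ^+ 2)^-1 <= 4^-1 :> R.
  have M1 : 1 <= M%:R :> R by rewrite ler1n; lia.
  rewrite lef_pV2 ?posrE ?mulr_gt0 ?exprn_gt0 //; nra.
have indep := edges_indep N_gt1 model.
have bad_le := pr_bad M2 bM0 bM (lexx _) mw indep edge_ge.
split; first exact/percolatesE/(infinite_pos M2 mw kappa0 kappa4 bad_le 0).
exact/unique_infinite_clusterE/(pr_unique M2 mw indep kappa0 kappa4 bad_le).
Qed.

End Transferred.

Theorem theorem3p1 :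
  (* (a) *)
  (forall (N : nat) (hN : (2 <= N)%N) (R : realType) (delta : R) (c : nat -> R)
          (d : measure_display) (T : measurableType d) (P : probability T R)
          (E : Omega N -> Omega N -> T -> bool),
      1 < delta ->
      (forall k, (0 < k)%N -> 0 < c k) ->
      (exists M : R, forall k, (0 < k)%N -> c k <= M) ->
      GN_model delta c P E ->
      ~ percolates (ltnW hN) P E)
  /\
  (* (b) *)
  (forall (N : nat) (hN : (2 <= N)%N) (R : realType) (delta : R),
      -1 < delta -> delta < 1 ->
      exists C : R,
        forall (c : nat -> R) (d : measure_display) (T : measurableType d)
               (P : probability T R) (E : Omega N -> Omega N -> T -> bool),
          (forall k, (0 < k)%N -> 0 < c k) ->
          (forall k, (0 < k)%N -> C <= c k) ->
          GN_model delta c P E ->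
          percolates (ltnW hN) P E /\ unique_infinite_cluster P E).
Proof.
split=> [N hN R delta c d T P E delta1 c0 cK model|N hN R delta delta0 delta1].
  exact: no_percolation model delta1 c0 cK.
have N1 : 1 < N%:R :> R by rewrite ltr1n.
have N0 : 0 < N%:R :> R by apply: lt_trans N1.
have r0 : 0 < N%:R `^ (1 + delta) / N%:R ^+ 2.
  by rewrite divr_gt0 ?exprn_gt0 // powR_gt0.
have r1 : N%:R `^ (1 + delta) / N%:R ^+ 2 < 1.
  rewrite ltr_pdivrMr ?exprn_gt0 // mul1r -powR_mulrn ?ler0n //.
  by apply: powR_lt => //; lra.
(* [delta < 1] makes the ratio less than 1, so its powers beat the factor 8; the maximum with 2
   provides [1 < L]. *)
have [L0 L0P] := geometric_small 8 r0 r1 ltr01.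
pose L := maxn L0 2.
exists (16 * (N ^ L)%:R ^+ 4 * (N%:R `^ (1 + delta)) ^+ L) => c d T P E _ cC model.
apply: (percolation hN model delta0 _ _ cC); first by rewrite leq_max orbT.
by apply: L0P; exact: leq_maxl.
Qed.
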